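(* Let $\varepsilon>0$ be fixed (small). There exists $x_0=x_0(\varepsilon)$ such that for every real $x\ge x_0$ and every real $y\ge x/(\log x)^{1-\varepsilon}$, the interval $[x,x+y]$ contains at least one prime number.
   Context: $\log$ denotes the natural logarithm. *)

(* Defs.v *)
From Stdlib Require Import Reals ZArith Znumtheory.

(* Main.v *)
(** Let [X] be about [ln x] and [D] a small multiple of [(ln x)^(-(1-eps))]. The von Mangoldt function
    is compared with the constant [1] through the sum of [(Lambda n - 1) n^(-s) h(w_n)], where
    [w_n = (ln n - X) / D], [s > 1] is very close to [1] and [h w = (1 - w^2/100) (sin w / w)^4].
    The Fourier transform of [h] is supported in [-4, 4], so such a sum is controlled by
    [-zeta'/zeta - zeta] at the points [s + it], [|t| <= 4/D]. Writing [X = ln n - D w_n] gains a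
    factor [1/X], the weight [ln n] turning [-zeta'/zeta - zeta] into its derivative (an integration
    by parts in disguise). Both functions are [O((1 + |t|)^c)] for every [c > 0], uniformly in [s],
    by the 3-4-1 inequality and Euler summation; hence the sum is [O(D^(-c) / X)], which is smaller
    than the main term, of order [D]. Since [h <= 0] off [-10, 10], a prime power lies in the window,
    and the proper prime powers are negligible. *)

From Stdlib Require Import Classical Reals Lra ZArith Znumtheory.
From Coquelicot Require Import Coquelicot.
From HB Require Import structures.
From mathcomp Require Import all_boot zify.
Require Import Defs.
Delimit Scope R_scope with R.
Set Implicit Arguments.
Unset Strict Implicit.
Unset Printing Implicit Defensive.
Open Scope R_scope.

(** The exponent is what shapes the proof. Without the factor 1/X the error D^(-c) never beats the
    main term D. With one such factor, and D of order X^(-(1-eps)), the ratio D^(-c) / (X D) is at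
    most a constant times X^(c-eps), so c = eps/2 suffices: a single derivative gives exactly the
    exponent 1 - eps. Everything happens at s = 1 + eta with 0 < eta <= 1 / (2 (X + 1)): all series
    converge absolutely and n^(-eta) stays above 1/2 up to the window. Uniformity of the bounds as s
    tends to 1 replaces analytic continuation and contours. The function h has three duties. Its
    sign confines positive contributions to the window; both h and w h(w) must be band-limited, the
    second because of the trade for 1/X; and h must decay like w^(-2), so that the negative tail
    costs only a small part of D. With (sin w / w)^2 in place of the fourth power, h would be
    band-limited but would not decay. *)

HB.instance Definition _ := Monoid.isComLaw.Build R 0 Rplus
  (fun x y z => esym (Rplus_assoc x y z)) Rplus_comm Rplus_0_l.
HB.instance Definition _ := Monoid.isMulLaw.Build R 0 Rmult Rmult_0_l Rmult_0_r.
HB.instance Definition _ :=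
  Monoid.isAddLaw.Build R Rmult Rplus Rmult_plus_distr_r Rmult_plus_distr_l.

Notation "\sum_ ( m <= i < n ) F" := (\big[Rplus/0%R]_(m <= i < n) F%R) : R_scope.

(** * von Mangoldt's function *)

Lemma sumR_pred1 (n k : nat) (F : nat -> R) :
  \sum_(0 <= i < n) (if k == i then F i else 0) = if (k < n)%N then F k else 0.
Proof.
elim: n => [|n IH]; first by rewrite big_nil.
rewrite big_nat_recr //= IH [in RHS]ltnS [in RHS]leq_eqVlt.
by case: (eqVneq k n) => [->|_] /=; rewrite ?ltnn /=; [ring | case: ifP => _; ring].
Qed.

Lemma sumR_const (n : nat) (c : R) : \sum_(0 <= i < n) c = INR n * c.
Proof.
elim: n => [|n IH]; first by rewrite big_nil /=; ring.
by rewrite big_nat_recr // IH S_INR /=; ring.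
Qed.

Lemma sumR_ge0 (m n : nat) (F : nat -> R) :
  (forall i, (m <= i < n)%N -> 0 <= F i) -> 0 <= \sum_(m <= i < n) F i.
Proof.
move=> h; rewrite big_nat; elim/big_ind: _ => //; [lra | move=> *; lra].
Qed.

Lemma sumR_le (m n : nat) (F G : nat -> R) :
  (forall i, (m <= i < n)%N -> F i <= G i) -> \sum_(m <= i < n) F i <= \sum_(m <= i < n) G i.
Proof.
move=> h; rewrite !(@big_nat _ _ _ m n); elim/big_ind2: _ => //; [lra | move=> *; lra].
Qed.

Lemma sumR_abs (m n : nat) (F : nat -> R) :
  Rabs (\sum_(m <= i < n) F i) <= \sum_(m <= i < n) Rabs (F i).
Proof.
elim/big_ind2: _ => [|x1 x2 y1 y2 h1 h2|i _]; rewrite ?Rabs_R0; try lra.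
by apply: Rle_trans (Rabs_triang _ _) _; lra.
Qed.

Lemma sumR_opp (m n : nat) (F : nat -> R) :
  \sum_(m <= i < n) - F i = - \sum_(m <= i < n) F i.
Proof. by symmetry; apply: (big_morph Ropp) => [x y|]; ring. Qed.

Lemma sumR_sub (m n : nat) (F G : nat -> R) :
  \sum_(m <= i < n) (F i - G i) = \sum_(m <= i < n) F i - \sum_(m <= i < n) G i.
Proof. by rewrite big_split sumR_opp. Qed.

Lemma sumR_recr (n : nat) (F : nat -> R) :
  \sum_(0 <= i < n.+1) F i = \sum_(0 <= i < n) F i + F n.
Proof. exact: big_nat_recr. Qed.

Lemma sumR_recl (n : nat) (F : nat -> R) :
  \sum_(0 <= i < n.+1) F i = F 0%N + \sum_(0 <= i < n) F i.+1.
Proof. exact: big_nat_recl. Qed.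

Lemma sumR_telescope (n : nat) (F : nat -> R) :
  \sum_(0 <= i < n) (F i.+1 - F i) = F n - F 0%N.
Proof.
elim: n => [|n IH]; first by rewrite big_nil; ring.
by rewrite big_nat_recr // IH /=; ring.
Qed.

Lemma sum_n_bigop (a : nat -> R) (n : nat) : sum_n a n = \sum_(0 <= i < n.+1) a i.
Proof.
elim: n => [|n IH]; first by rewrite sum_O big_nat1.
by rewrite sum_Sn IH [in RHS]big_nat_recr.
Qed.

Lemma exp_mono x y : x <= y -> exp x <= exp y.
Proof. by case/Rle_lt_or_eq_dec => [/exp_increasing/Rlt_le|->]; [|apply: Rle_refl]. Qed.

Lemma ln_ge0 x : 1 <= x -> 0 <= ln x.
Proof. by move=> h; rewrite -ln_1; apply: ln_le; lra. Qed.

Lemma ln_INR_ge0 n : 0 <= ln (INR n).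
Proof.
case: n => [|n]; first by rewrite /ln; case: Rlt_dec => [/Rlt_irrefl|_] //; lra.
apply: ln_ge0; rewrite S_INR; have := pos_INR n; lra.
Qed.

Lemma INR_gt0 n : (0 < n)%N -> 0 < INR n.
Proof. by move=> h; apply: lt_0_INR; lia. Qed.

Lemma INR_ge1 n : (0 < n)%N -> 1 <= INR n.
Proof. by move=> h; apply: (le_INR 1); lia. Qed.

Lemma INR_muln m n : INR (m * n)%N = INR m * INR n.
Proof. exact: mult_INR. Qed.

Lemma ln_INR_mul m n : (0 < m)%N -> (0 < n)%N -> ln (INR (m * n)%N) = ln (INR m) + ln (INR n).
Proof. by move=> hm hn; rewrite INR_muln ln_mult //; exact: INR_gt0. Qed.

Lemma ln_INR_exp p k : (0 < p)%N -> ln (INR (p ^ k)%N) = INR k * ln (INR p).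
Proof.
move=> hp; elim: k => [|k IH]; first by rewrite expn0 /= ln_1; ring.
by rewrite expnS ln_INR_mul ?expn_gt0 ?hp // IH S_INR; ring.
Qed.

Lemma ln_INR_logn n : (0 < n)%N ->
  ln (INR n) = \sum_(0 <= p < n.+1) (INR (logn p n) * ln (INR p)).
Proof.
move=> n0; rewrite -[in LHS](partnT n0) /partn.
have -> : \prod_(0 <= p < n.+1 | p \in predT) p ^ logn p n = \prod_(0 <= p < n.+1) p ^ logn p n by [].
have [h1 h2] : (0 < \prod_(0 <= p < n.+1) p ^ logn p n)%N /\
  ln (INR (\prod_(0 <= p < n.+1) p ^ logn p n)%N) = \sum_(0 <= p < n.+1) (INR (logn p n) * ln (INR p));
  last by [].
(* Positivity of the partial product is carried along, because [ln] is additive only on positive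
   factors. For [p = 0] the factor is 0^0 = 1. *)
elim/big_rec2: _ => [|p x y _ [y0 IH]]; first by split => //; rewrite /= ln_1.
have pp : (0 < p ^ logn p n)%N.
  by case: p => [|p]; rewrite ?expn_gt0 // lognE.
split; first by rewrite muln_gt0 pp.
rewrite ln_INR_mul // -IH; congr (_ + _).
case: p pp => [|p] _; last by rewrite ln_INR_exp.
by rewrite lognE /= ln_1; ring.
Qed.

Definition vonM (n : nat) : R :=
  \sum_(0 <= p < n.+1) \sum_(0 <= k < n)
    (if prime p && (p ^ k.+1 == n)%N then ln (INR p) else 0).

(** A solution of p^(k+1) = n has p <= n and k < n, so a larger box contains no further pair. A
    common box for all divisors of one number allows sums to be exchanged. *)
Lemma vonM_widen n m : (n <= m)%N ->
  vonM n = \sum_(0 <= p < m.+1) \sum_(0 <= k < m)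
    (if prime p && (p ^ k.+1 == n)%N then ln (INR p) else 0).
Proof.
move=> nm; rewrite /vonM (@big_nat_widen _ _ _ _ n.+1 m.+1) //.
rewrite big_mkcond; apply: eq_big_nat => p _.
case: ltnP => hp.
  rewrite (@big_nat_widen _ _ _ _ n m) // big_mkcond; apply: eq_big_nat => k _ /=.
  case: ltnP => // hk; case: ifP => // /andP[pp /eqP e].
  have := ltn_expl k.+1 (prime_gt1 pp); lia.
symmetry; apply: big1 => k _; case: ifP => // /andP[pp /eqP e].
have : (p ^ 1 <= p ^ k.+1)%N by rewrite leq_exp2l // prime_gt1.
rewrite e expn1; lia.
Qed.

Lemma vonM_ge0 n : 0 <= vonM n.
Proof.
apply: sumR_ge0 => p _; apply: sumR_ge0 => k _; case: ifP => _; [exact: ln_INR_ge0 | lra].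
Qed.

Lemma vonM_neq0 n : vonM n <> 0 -> exists p k, prime p /\ n = (p ^ k.+1)%N.
Proof.
move=> h; apply: NNPP => hn; apply: h; rewrite /vonM big1 // => p _; rewrite big1 // => k _.
by case: ifP => // /andP[pp /eqP e]; case: hn; exists p, k.
Qed.

(** Dirichlet convolution over pairs in a box rather than over divisors, the form that [conv_lim]
    compares with a product of partial sums. *)
Definition conv (a b : nat -> R) (n : nat) : R :=
  \sum_(0 <= d < n.+1) \sum_(0 <= e < n.+1) (if (d * e == n)%N then a d * b e else 0).

Lemma conv_eq (a b c d : nat -> R) n :
  (forall i j, (i * j = n)%N -> a i * b j = c i * d j) -> conv a b n = conv c d n.
Proof.
move=> h; rewrite /conv; apply: eq_bigr => i _; apply: eq_bigr => j _.
by case: eqP => // /h.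
Qed.

Lemma conv1 (a : nat -> R) n : (0 < n)%N ->
  conv a (fun _ => 1) n = \sum_(0 <= d < n.+1) (if (d %| n)%N then a d else 0).
Proof.
move=> n0; apply: eq_big_nat => d _; case: ifP => hd; last first.
  by rewrite big1 // => e _; case: eqP => // he; move: hd; rewrite -he dvdn_mulr.
have d0 := dvdn_gt0 n0 hd.
rewrite -[RHS](_ : (if (n %/ d < n.+1)%N then a d else 0) = _); last by rewrite ltnS leq_div.
rewrite -(sumR_pred1 _ _ (fun=> a d)); apply: eq_bigr => e _.
by rewrite -[in X in if X then _ else _](divnK hd) [(d * e)%N]mulnC eqn_pmul2r // Rmult_1_r eq_sym.
Qed.

Lemma conv_vonM1 n : (0 < n)%N -> conv vonM (fun _ => 1) n = ln (INR n).
Proof.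
move=> n0; rewrite conv1 // ln_INR_logn //.
(* All [vonM d] are put on the box of [n], so that the sum over [d] can be moved inside. For each
   prime [p] it then counts the exponents [k + 1 <= logn p n]. *)
rewrite (@eq_big_nat _ _ _ _ _ _ (fun d => \sum_(0 <= p < n.+1) \sum_(0 <= k < n)
   (if (p ^ k.+1 == d)%N then (if prime p && (d %| n)%N then ln (INR p) else 0) else 0))); last first.
  move=> d hd; case: ifP => hdn; last first.
    by rewrite big1 // => p _; rewrite big1 // => k _; rewrite andbF; case: ifP.
  rewrite (@vonM_widen d n); last by lia.
  by apply: eq_bigr => p _; apply: eq_bigr => k _; rewrite andbT; case: (prime p); case: ifP.
rewrite exchange_big_nat /=; apply: eq_big_nat => p _.
rewrite exchange_big_nat /=.
have -> : \sum_(0 <= k < n) \sum_(0 <= d < n.+1)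
  (if (p ^ k.+1 == d)%N then (if prime p && (d %| n)%N then ln (INR p) else 0) else 0)
  = \sum_(0 <= k < n) (if (k < logn p n)%N then ln (INR p) else 0).
  apply: eq_big_nat => k _.
  rewrite (sumR_pred1 _ _ (fun d => if prime p && (d %| n)%N then ln (INR p) else 0)).
  case pp : (prime p) => /=; last first.
    by rewrite lognE pp /=; case: ifP.
  rewrite pfactor_dvdn // ltnS; case: ifP => // h; case: ifP => // h2.
  by have /(dvdn_leq n0) : (p ^ k.+1 %| n)%N by [rewrite pfactor_dvdn]; rewrite h.
rewrite -big_mkcond /= -(@big_nat_widen _ _ _ _ (logn p n) n (fun=> true)) ?sumR_const //.
exact/ltnW/ltn_logl.
Qed.

(** Keep only the term d = n of [conv_vonM1]; the others are nonnegative. *)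
Lemma vonM_le_ln n : vonM n <= ln (INR n).
Proof.
case: n => [|n].
  by rewrite /vonM big1 ?big_nil //; [exact: ln_INR_ge0 | move=> *; rewrite big_nil].
rewrite -(conv_vonM1 (ltn0Sn n)) conv1 // big_nat_recr //= dvdnn.
rewrite -[X in X <= _]Rplus_0_l; apply: Rplus_le_compat_r.
by apply: sumR_ge0 => i _; case: ifP => _; [exact: vonM_ge0 | lra].
Qed.

Lemma conv_addr (a b c : nat -> R) n :
  conv a (fun m => b m + c m) n = conv a b n + conv a c n.
Proof.
rewrite /conv -big_split /=; apply: eq_bigr => i _; rewrite -big_split /=.
by apply: eq_bigr => j _; case: ifP => _; ring.
Qed.

(** Coefficient form of the derivative of (-zeta'/zeta) zeta = -zeta'. Multiplication by [ln] is a
    derivation for the convolution: with d e = n, write ln d = ln n - ln e. *)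
Lemma conv_vonM_ln2 n : (0 < n)%N ->
  conv (fun d => vonM d * ln (INR d)) (fun _ => 1) n + conv vonM (fun e => ln (INR e)) n
  = ln (INR n) ^ 2.
Proof.
move=> n0.
have -> : conv (fun d => vonM d * ln (INR d)) (fun _ => 1) n =
          conv vonM (fun e => ln (INR n) - ln (INR e)) n.
  apply: conv_eq => i j e; have [i0 j0] : (0 < i)%N /\ (0 < j)%N by lia.
  by rewrite -e ln_INR_mul //; ring.
rewrite -conv_addr.
transitivity (conv (fun d => ln (INR n) * vonM d) (fun _ => 1) n).
  by apply: conv_eq => i j _; ring.
transitivity (ln (INR n) * conv vonM (fun _ => 1) n); last by rewrite conv_vonM1 //; ring.
rewrite /conv [RHS]big_distrr /=; apply: eq_bigr => i _; rewrite [RHS]big_distrr /=.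
by apply: eq_bigr => j _; case: ifP => _; ring.
Qed.

(** A proper prime power n = p^(k+1) < M has k >= 1, whence p^2 < M <= Rt^2, and 2^k < M <= 2^K. So
    there are at most Rt K of them, each of weight at most ln M. *)
Lemma vonM_nonprime_sum (M Rt K : nat) : (M <= Rt * Rt)%N -> (M <= 2 ^ K)%N ->
  \sum_(0 <= n < M) (if prime n then 0 else vonM n) <= INR Rt * INR K * ln (INR M).
Proof.
move=> hR hK.
have E n : (n < M)%N -> (if prime n then 0 else vonM n) <=
   \sum_(0 <= p < Rt) \sum_(0 <= k < K) (if (p ^ k.+1 == n)%N then ln (INR M) else 0).
  move=> hn.
  have P0 : 0 <= \sum_(0 <= p < Rt) \sum_(0 <= k < K) (if (p ^ k.+1 == n)%N then ln (INR M) else 0).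
    by apply: sumR_ge0 => p _; apply: sumR_ge0 => k _; case: ifP => _; [exact: ln_INR_ge0|lra].
  case: ifP => // npr; case: (Req_dec (vonM n) 0) => [->|] // /vonM_neq0 [p [k [pp e]]].
  have p1 := prime_gt1 pp.
  have k0 : (0 < k)%N by case: k e npr => // e; rewrite e expn1 pp.
  have pR : (p < Rt)%N.
    rewrite -ltn_sqr -!mulnn; apply: leq_trans hR; apply: leq_ltn_trans hn.
    by rewrite e mulnn leq_exp2l.
  have kK : (k < K)%N.
    rewrite -(@ltn_exp2l 2) //; apply: leq_trans hK; apply: leq_ltn_trans hn.
    by rewrite e; apply: leq_trans (_ : p ^ k <= _)%N; [rewrite leq_exp2r | rewrite leq_exp2l].
  have n0 : (0 < n)%N by rewrite e expn_gt0; lia.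
  apply: (@Rle_trans _ (ln (INR M))).
    apply: Rle_trans (vonM_le_ln n) _; apply: ln_le; [exact: INR_gt0 | apply: le_INR; lia].
  have pick q (F : nat -> R) N : (q < N)%N -> (forall i, 0 <= F i) -> F q <= \sum_(0 <= i < N) F i.
    move=> hq hF; rewrite (@big_cat_nat _ _ _ q.+1) //= big_nat_recr //=.
    have := @sumR_ge0 0 q F (fun i _ => hF i); have := @sumR_ge0 q.+1 N F (fun i _ => hF i); lra.
  have H i j : 0 <= (if (i ^ j.+1 == n)%N then ln (INR M) else 0).
    by case: ifP => _; [exact: ln_INR_ge0|lra].
  apply: (@Rle_trans _ (\sum_(0 <= j < K) (if (p ^ j.+1 == n)%N then ln (INR M) else 0))).
    have := pick k (fun j => if (p ^ j.+1 == n)%N then ln (INR M) else 0) K kK (H p).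
    by rewrite {1}e eqxx.
  apply: (pick p (fun p => \sum_(0 <= j < K) (if (p ^ j.+1 == n)%N then ln (INR M) else 0))) => // i.
  by apply: sumR_ge0.
apply: (@Rle_trans _ (\sum_(0 <= n < M) \sum_(0 <= p < Rt) \sum_(0 <= k < K)
   (if (p ^ k.+1 == n)%N then ln (INR M) else 0))).
  by apply: sumR_le => n /andP[_ hn]; exact: E.
rewrite exchange_big_nat /= Rmult_assoc -sumR_const; apply: sumR_le => p _.
rewrite exchange_big_nat /= -sumR_const; apply: sumR_le => k _.
rewrite (sumR_pred1 _ _ (fun=> ln (INR M))); case: ifP => _; [lra | exact: ln_INR_ge0].
Qed.

(** * Dirichlet series on [Re s > 1] *)

Lemma is_lim_seq_sum (a : nat -> R) : ex_series a ->
  is_lim_seq (fun N => \sum_(0 <= n < N) a n) (Series a).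
Proof.
move=> /Series_correct h; apply/is_lim_seq_incr_1.
by apply: (is_lim_seq_ext (sum_n a)) => // n; exact: sum_n_bigop.
Qed.

Lemma ex_series_bounded (a : nat -> R) M : (forall n, 0 <= a n) ->
  (forall N, \sum_(0 <= n < N) a n <= M) -> ex_series a.
Proof.
move=> a0 hM.
have [l hl] : ex_finite_lim_seq (sum_n a).
  apply: (@ex_finite_lim_seq_incr _ M) => n; last by rewrite sum_n_bigop.
  by rewrite sum_Sn /plus /=; have := a0 n.+1; lra.
by exists l.
Qed.

Lemma sum_le_Series (a : nat -> R) N : (forall n, 0 <= a n) -> ex_series a ->
  \sum_(0 <= n < N) a n <= Series a.
Proof.
move=> a0 /is_lim_seq_sum h.
apply: (is_lim_seq_incr_compare _ _ h) => n.
by rewrite big_nat_recr //=; have := a0 n; lra.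
Qed.

Lemma Series_le_bound (a : nat -> R) M : ex_series a ->
  (forall N, \sum_(0 <= n < N) a n <= M) -> Series a <= M.
Proof.
move=> /is_lim_seq_sum h hM.
exact: (is_lim_seq_le _ _ _ _ hM h (is_lim_seq_const M)).
Qed.

Lemma ex_series_dom (a b : nat -> R) : (forall n, Rabs (a n) <= b n) -> ex_series b -> ex_series a.
Proof. by move=> h hb; apply: (ex_series_le _ b). Qed.

(** The right side depends on the majorant alone, which is what makes truncation uniform in [t] in
    [Dir_approx]. *)
Lemma Series_tail (a b : nat -> R) N : (forall n, Rabs (a n) <= b n) -> ex_series b ->
  Rabs (Series a - \sum_(0 <= n < N) a n) <= Series b - \sum_(0 <= n < N) b n.
Proof.
move=> hab hb; have ha := ex_series_dom hab hb.
have la := is_lim_seq_abs _ _ (is_lim_seq_minus' _ _ _ _ (is_lim_seq_sum ha)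
  (is_lim_seq_const (\sum_(0 <= n < N) a n))).
have lb := is_lim_seq_minus' _ _ _ _ (is_lim_seq_sum hb)
  (is_lim_seq_const (\sum_(0 <= n < N) b n)).
apply: (is_lim_seq_le_loc _ _ _ _ _ la lb); exists N => M /leP NM.
rewrite !(@big_cat_nat _ _ _ N 0 M) //= /Rminus !(Rplus_comm (\sum_(0 <= i < N) _)) !Rplus_assoc
  !Rplus_opp_r !Rplus_0_r.
by apply: Rle_trans (sumR_abs _ _ _) _; apply: sumR_le => i _; exact: hab.
Qed.

Lemma Series_abs_bound (a b : nat -> R) M : (forall n, Rabs (a n) <= b n) ->
  (forall N, \sum_(0 <= n < N) b n <= M) -> ex_series a /\ Rabs (Series a) <= M.
Proof.
move=> hab hM.
have hb : ex_series b.
  by apply: ex_series_bounded hM => n; apply: Rle_trans (hab n); exact: Rabs_pos.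
split; first exact: ex_series_dom hb.
have := @Series_tail a b 0 hab hb; rewrite !big_nil !Rminus_0_r => h.
exact: Rle_trans h (Series_le_bound hb hM).
Qed.

(** The power n^(-s). The case 0 is set apart because [ln 0 = 0] would give the value 1; with the
    value 0 the index 0 drops out of every series, and [nps] is completely multiplicative without
    exception. *)
Definition nps (s : R) (n : nat) : R := if n is 0%N then 0 else exp (- s * ln (INR n)).

Lemma nps_ge0 s n : 0 <= nps s n.
Proof. by case: n => [|n]; [exact: Rle_refl | apply/Rlt_le/exp_pos]. Qed.

Lemma nps_gt0 s n : (0 < n)%N -> nps s n = exp (- s * ln (INR n)).
Proof. by case: n. Qed.

Lemma nps_mul s m n : nps s (m * n)%N = nps s m * nps s n.
Proof.
case: m => [|m]; first by rewrite mul0n /=; ring.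
case: n => [|n]; first by rewrite muln0 /=; ring.
by rewrite !nps_gt0 // ?muln_gt0 // ln_INR_mul // -exp_plus; congr exp; ring.
Qed.

Lemma nps1 n : nps 1 n = / INR n \/ n = 0%N.
Proof.
case: n => [|n]; [by right | left].
rewrite nps_gt0 // (_ : - (1) * _ = - ln (INR n.+1)); last by ring.
by rewrite exp_Ropp exp_ln //; exact: INR_gt0.
Qed.

Lemma nps_anti s s' n : s <= s' -> nps s' n <= nps s n.
Proof.
case: n => [|n] h; [exact: Rle_refl | rewrite !nps_gt0 //].
by have := ln_INR_ge0 n.+1 => h0; apply: exp_mono; nra.
Qed.

Lemma exp_ge_lin x : 1 + x <= exp x.
Proof.
case: (Req_dec x 0) => [->|h]; first by rewrite exp_0; lra.
exact/Rlt_le/exp_ineq1.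
Qed.

Lemma ln_le_lin x : 0 < x -> ln x <= x - 1.
Proof. by move=> h; have := exp_ge_lin (ln x); rewrite exp_ln //; lra. Qed.

Lemma ln_step n : (0 < n)%N ->
  / INR n.+1 <= ln (INR n.+1) - ln (INR n) <= / INR n.
Proof.
move=> n0; have h := INR_gt0 n0; have h1 := @INR_gt0 n.+1 isT; rewrite S_INR in h1 *.
have e1 : ln (INR n + 1) - ln (INR n) = ln ((INR n + 1) / INR n).
  by rewrite /Rdiv ln_mult ?ln_Rinv //; apply: Rinv_0_lt_compat.
have e2 : ln (INR n) - ln (INR n + 1) = ln (INR n / (INR n + 1)).
  by rewrite /Rdiv ln_mult ?ln_Rinv //; apply: Rinv_0_lt_compat.
split.
  have := @ln_le_lin (INR n / (INR n + 1)) (Rdiv_lt_0_compat _ _ h h1); rewrite -e2.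
  rewrite (_ : INR n / (INR n + 1) - 1 = - / (INR n + 1)); [lra | field; lra].
rewrite e1; apply: Rle_trans (ln_le_lin (Rdiv_lt_0_compat _ _ h1 h)) _.
rewrite (_ : (INR n + 1) / INR n - 1 = / INR n); [lra | field; lra].
Qed.

Lemma sum_nps_bound k N : 0 < k -> \sum_(0 <= n < N) nps (1 + k) n <= 1 + / k.
Proof.
move=> k0; have ik := Rinv_0_lt_compat _ k0.
(* The integral test in a form that passes through the induction: the bound with its tail (M+1)^(-k)
   kept. The step is e^x >= 1 + x at x = k (ln (M+2) - ln (M+1)). *)
suff h M : \sum_(0 <= n < M.+2) nps (1 + k) n <= 1 + / k * (1 - exp (- k * ln (INR M.+1))).
  case: N => [|[|M]]; rewrite ?big_nil ?big_nat1 /=; try lra.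
  by apply: Rle_trans (h M) _; have := exp_pos (- k * ln (INR M.+1)); nra.
elim: M => [|M IH].
  rewrite big_nat_recr //= big_nat1 /= ln_1 !Rmult_0_r exp_0; lra.
rewrite sumR_recr; apply: Rle_trans (Rplus_le_compat_r _ _ _ IH) _.
rewrite nps_gt0 //.
have [h1 h2] := @ln_step M.+1 isT.
set v := ln (INR M.+1) in h1 h2 *; set v' := ln (INR M.+2) in h1 h2 *.
have e1 : exp (- (1 + k) * v') = exp (- k * v') * / INR M.+2.
  rewrite (_ : - (1 + k) * v' = - k * v' + - v'); last by ring.
  by rewrite exp_plus exp_Ropp exp_ln //; exact: INR_gt0.
have e2 : exp (- k * v) = exp (- k * v') * exp (k * (v' - v)).
  by rewrite -exp_plus; congr exp; ring.
have h3 := exp_ge_lin (k * (v' - v)); have p := exp_pos (- k * v').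
rewrite e1 e2.
have : exp (- k * v') * (k * / INR M.+2) <= exp (- k * v') * (exp (k * (v' - v)) - 1).
  apply: Rmult_le_compat_l; first lra.
  have : k * / INR M.+2 <= k * (v' - v) by apply: Rmult_le_compat_l; lra.
  lra.
move/(Rmult_le_compat_l (/ k)) => /(_ (Rlt_le _ _ ik)).
rewrite (_ : / k * (exp (- k * v') * (k * / INR M.+2)) = exp (- k * v') * / INR M.+2); last first.
  by field; split; [have := @INR_gt0 M.+2 isT; lra | lra].
lra.
Qed.

Lemma poly_exp k : 0 < k -> exists2 C, 0 < C & forall v, 0 <= v -> (1 + v) ^ 2 <= C * exp (k * v).
Proof.
(* With this [m], m (1 + v) <= 1 + k v / 2 <= e^(k v / 2); then square. *)
move=> k0; pose m := Rmin 1 (k / 2).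
have m0 : 0 < m by apply: Rmin_pos; lra.
have m1 : m <= 1 := Rmin_l _ _; have m2 : m <= k / 2 := Rmin_r _ _.
exists (/ m ^ 2) => [|v v0]; first by apply: Rinv_0_lt_compat; apply: pow_lt.
have h : m * (1 + v) <= exp (k / 2 * v).
  apply: Rle_trans (exp_ge_lin _); nra.
have e : exp (k * v) = exp (k / 2 * v) ^ 2.
  by rewrite /= Rmult_1_r -exp_plus; congr exp; field.
have : (m * (1 + v)) ^ 2 <= exp (k * v).
  rewrite e; apply: pow_incr; split => //; nra.
rewrite Rpow_mult_distr => h2.
apply: (Rmult_le_reg_l (m ^ 2)); first exact: pow_lt.
rewrite -Rmult_assoc Rinv_r; first lra.
apply/not_eq_sym/Rlt_not_eq; exact: pow_lt.
Qed.

(** Growth class of the coefficients: two logarithms are enough for 1, ln, ln^2, Lambda and Lambda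
    ln, the only sequences that occur, and for their differences and convolutions here. *)
Definition adm (a : nat -> R) := exists2 K, 0 <= K & forall n, Rabs (a n) <= K * (1 + ln (INR n)) ^ 2.

Lemma adm_1 : adm (fun=> 1).
Proof.
exists 1; first lra; move=> n; rewrite Rabs_R1; have := ln_INR_ge0 n; nra.
Qed.

Lemma adm_ln : adm (fun n => ln (INR n)).
Proof.
exists 1; first lra; move=> n; have := ln_INR_ge0 n => h; rewrite Rabs_pos_eq; nra.
Qed.

Lemma adm_ln2 : adm (fun n => ln (INR n) ^ 2).
Proof.
exists 1; first lra; move=> n; have := ln_INR_ge0 n => h; rewrite Rabs_pos_eq; nra.
Qed.

Lemma adm_le (a b : nat -> R) : adm b -> (forall n, Rabs (a n) <= Rabs (b n)) -> adm a.
Proof. by move=> [K K0 h] hab; exists K => // n; apply: Rle_trans (hab n) (h n). Qed.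

Lemma adm_vonM : adm vonM.
Proof.
apply: adm_le adm_ln _ => n; rewrite !Rabs_pos_eq; [exact: vonM_le_ln | exact: ln_INR_ge0 | exact: vonM_ge0].
Qed.

Lemma adm_vonM_ln : adm (fun n => vonM n * ln (INR n)).
Proof.
apply: adm_le adm_ln2 _ => n; have h1 := vonM_ge0 n; have h2 := vonM_le_ln n; have h3 := ln_INR_ge0 n.
rewrite !Rabs_pos_eq; nra.
Qed.

Lemma adm_sub (a b : nat -> R) : adm a -> adm b -> adm (fun n => a n - b n).
Proof.
move=> [K K0 h] [L L0 g]; exists (K + L); first lra.
move=> n; apply: Rle_trans (Rabs_triang _ _) _; rewrite Rabs_Ropp; have := h n; have := g n; lra.
Qed.

Lemma adm_sum_bound (a : nat -> R) s : adm a -> 1 < s ->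
  exists M, forall N, \sum_(0 <= n < N) (Rabs (a n) * nps s n) <= M.
Proof.
(* Half of the excess s - 1 pays for the logarithms, the other half for convergence. *)
move=> [K K0 h] s1; pose k := (s - 1) / 2; have k0 : 0 < k by rewrite /k; lra.
have [C C0 hC] := poly_exp k0.
exists (K * C * (1 + / k)) => N.
apply: Rle_trans (Rmult_le_compat_l (K * C) _ _ _ (sum_nps_bound N k0)); last by nra.
rewrite [X in _ <= X]big_distrr /=; apply: sumR_le => n _.
case: n => [|n]; first by rewrite /=; lra.
rewrite !nps_gt0 //; set v := ln _; have v0 : 0 <= v := ln_INR_ge0 _.
have -> : exp (- (1 + k) * v) = exp (k * v) * exp (- s * v).
  by rewrite -exp_plus; congr exp; rewrite /k; field.
rewrite -Rmult_assoc; apply: Rmult_le_compat_r; first exact/Rlt_le/exp_pos.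
apply: Rle_trans (h _) _; rewrite Rmult_assoc; apply: Rmult_le_compat_l => //; exact: hC.
Qed.

Lemma adm_summable (a : nat -> R) s : adm a -> 1 < s -> ex_series (fun n => Rabs (a n) * nps s n).
Proof.
move=> ha s1; have [M hM] := adm_sum_bound ha s1; apply: ex_series_bounded hM => n.
by apply: Rmult_le_pos; [exact: Rabs_pos | exact: nps_ge0].
Qed.

Definition dcos (s t : R) (n : nat) : R := nps s n * cos (t * ln (INR n)).
Definition dsin (s t : R) (n : nat) : R := nps s n * sin (t * ln (INR n)).

Lemma dcos_abs s t n : Rabs (dcos s t n) <= nps s n.
Proof.
rewrite /dcos Rabs_mult (Rabs_pos_eq _ (nps_ge0 s n)) -{2}[nps s n]Rmult_1_r.
apply: Rmult_le_compat_l; first exact: nps_ge0.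
by apply: Rabs_le; exact: COS_bound.
Qed.

Lemma dsin_abs s t n : Rabs (dsin s t n) <= nps s n.
Proof.
rewrite /dsin Rabs_mult (Rabs_pos_eq _ (nps_ge0 s n)) -{2}[nps s n]Rmult_1_r.
apply: Rmult_le_compat_l; first exact: nps_ge0.
by apply: Rabs_le; exact: SIN_bound.
Qed.

Lemma mul_abs_le (a z w : R) : Rabs z <= w -> Rabs (a * z) <= Rabs a * w.
Proof. by move=> h; rewrite Rabs_mult; apply: Rmult_le_compat_l => //; exact: Rabs_pos. Qed.

(** The series of a_n n^(-s-it) as a pair of real series; the minus sign comes from n^(-it) = cos (t
    ln n) - i sin (t ln n). *)
Definition Dir (a : nat -> R) (s t : R) : C :=
  (Series (fun n => a n * dcos s t n), - Series (fun n => a n * dsin s t n)).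

Lemma ex_dcos a s t : adm a -> 1 < s -> ex_series (fun n => a n * dcos s t n).
Proof.
move=> ha s1; apply: ex_series_dom (adm_summable ha s1) => n; exact/mul_abs_le/dcos_abs.
Qed.

Lemma ex_dsin a s t : adm a -> 1 < s -> ex_series (fun n => a n * dsin s t n).
Proof.
move=> ha s1; apply: ex_series_dom (adm_summable ha s1) => n; exact/mul_abs_le/dsin_abs.
Qed.

Lemma Dir_ext a b s t : (forall n, (0 < n)%N -> a n = b n) -> Dir a s t = Dir b s t.
Proof.
move=> h; rewrite /Dir; f_equal; [|f_equal]; apply: Series_ext => -[|n]; last 1 first.
- by rewrite h.
- by rewrite /dcos /= Rmult_0_l !Rmult_0_r.
- by rewrite h.
- by rewrite /dsin /= Rmult_0_l !Rmult_0_r.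
Qed.

Lemma Dir_sub a b s t : adm a -> adm b -> 1 < s ->
  Dir (fun n => a n - b n) s t = (Dir a s t - Dir b s t)%C.
Proof.
move=> ha hb s1; rewrite /Dir /Cminus /Cplus /Copp /=; congr (_, _).
  rewrite -[X in _ = X]/(_ - _) -Series_minus; try exact: ex_dcos.
  by apply: Series_ext => n; ring.
rewrite Ropp_involutive Rplus_comm -[X in _ = X]/(_ - _) -Series_minus; try exact: ex_dsin.
by rewrite -Series_opp; apply: Series_ext => n; ring.
Qed.

(** The threshold does not depend on [t]: later one truncation has to serve all frequencies of the
    band at once. *)
Lemma Dir_approx a s e : adm a -> 1 < s -> 0 < e -> exists N0, forall N t, (N0 <= N)%N ->
  Rabs (fst (Dir a s t) - \sum_(0 <= n < N) (a n * dcos s t n)) <= e /\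
  Rabs (- snd (Dir a s t) - \sum_(0 <= n < N) (a n * dsin s t n)) <= e.
Proof.
move=> ha s1 e0; have hs := adm_summable ha s1.
have /is_lim_seq_Reals/(_ e e0)[N0 hN] := is_lim_seq_sum hs.
exists N0 => N t /leP/hN; rewrite /R_dist => hS.
have hS2 : Series (fun n => Rabs (a n) * nps s n) - \sum_(0 <= n < N) (Rabs (a n) * nps s n) <= e.
  by move: hS; rewrite Rabs_minus_sym => hS; have := Rle_abs (Series (fun n => Rabs (a n) * nps s n) - \sum_(0 <= n < N) (Rabs (a n) * nps s n)); lra.
split; rewrite /= ?Ropp_involutive; apply: Rle_trans hS2; apply: Series_tail => // n;
  apply: mul_abs_le; [exact: dcos_abs | exact: dsin_abs].
Qed.

Lemma dcos_mul s t m n :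
  dcos s t (m * n)%N = dcos s t m * dcos s t n - dsin s t m * dsin s t n.
Proof.
rewrite /dcos /dsin nps_mul.
case: m => [|m]; first by rewrite /=; ring.
case: n => [|n]; first by rewrite /=; ring.
by rewrite ln_INR_mul // Rmult_plus_distr_l cos_plus; ring.
Qed.

Lemma dsin_mul s t m n :
  dsin s t (m * n)%N = dsin s t m * dcos s t n + dcos s t m * dsin s t n.
Proof.
rewrite /dcos /dsin nps_mul.
case: m => [|m]; first by rewrite /=; ring.
case: n => [|n]; first by rewrite /=; ring.
by rewrite ln_INR_mul // Rmult_plus_distr_l sin_plus; ring.
Qed.

Lemma sumR_mul (a b : nat -> R) M N :
  (\sum_(0 <= i < M) a i) * (\sum_(0 <= j < N) b j) =
  \sum_(0 <= i < M) \sum_(0 <= j < N) (a i * b j).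
Proof. by rewrite big_distrl /=; apply: eq_bigr => i _; rewrite big_distrr. Qed.

Lemma exp_ln_lim0 k : 0 < k -> is_lim_seq (fun N => exp (- k * ln (INR N))) 0.
Proof.
move=> k0.
apply: (is_lim_comp_seq (fun x => exp x) (fun N => - k * ln (INR N)) m_infty 0 is_lim_exp_m) => //.
  by exists 0%N.
have -> : m_infty = Rbar_mult (Rbar.Finite (- k)) p_infty.
  by rewrite /= /Rbar_mult /=; case: Rle_dec => [h|h] //; exfalso; lra.
apply: is_lim_seq_scal_l.
apply: (is_lim_comp_seq ln INR p_infty p_infty is_lim_ln_p) => //; first by exists 0%N.
exact: is_lim_seq_INR.
Qed.

(* The part [d * e >= N] of the double sum is [O(N^(-k))], with [s = 1 + 2 k]. *)
Lemma conv_lim (a b z : nat -> R) s : adm a -> adm b -> 1 < s ->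
  (forall n, Rabs (z n) <= nps s n) ->
  is_lim_seq (fun N => \sum_(0 <= d < N) \sum_(0 <= e < N) (a d * b e * z (d * e)%N)
                       - \sum_(0 <= n < N) (conv a b n * z n)) 0.
Proof.
move=> ha hb s1 hz; pose k := (s - 1) / 2; have k0 : 0 < k by rewrite /k; lra.
have k1 : 1 < 1 + k by lra.
have [A hA] := adm_sum_bound ha k1; have [B hB] := adm_sum_bound hb k1.
have A0 : 0 <= A by have := hA 0%N; rewrite big_nil.
have B0 : 0 <= B by have := hB 0%N; rewrite big_nil.
have z0 : z 0%N = 0 by have := hz 0%N; rewrite /= => h; apply: NNPP => /Rabs_no_R0; have := Rabs_pos (z 0%N); lra.
have E N : \sum_(0 <= n < N) (conv a b n * z n) =
  \sum_(0 <= d < N) \sum_(0 <= e < N) (if (d * e < N)%N then a d * b e * z (d * e)%N else 0).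
  transitivity (\sum_(0 <= n < N) \sum_(0 <= d < N) \sum_(0 <= e < N)
     (if (d * e == n)%N then a d * b e * z n else 0)).
    apply: eq_big_nat => n /andP[_ nN]; case: n nN => [|n] nN.
      rewrite z0 Rmult_0_r big1 // => d _; rewrite big1 // => e _; case: ifP => _ //; ring.
    rewrite /conv big_distrl /= (@big_nat_widen _ _ _ _ n.+2 N) // big_mkcond.
    apply: eq_big_nat => d _ /=; case: ltnP => hd; last first.
      symmetry; apply: big1 => e _; case: eqP => // h; case: e h => [|e]; rewrite ?muln0 // => h.
      by have := leq_pmulr d (ltn0Sn e); rewrite h; lia.
    rewrite big_distrl /= (@big_nat_widen _ _ _ _ n.+2 N) // big_mkcond.
    apply: eq_big_nat => e _ /=; case: ltnP => he; first by case: eqP => _; ring.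
    case: eqP => // h; case: d {hd} h => [|d] h; first by rewrite mul0n in h.
    by have := leq_pmull e (ltn0Sn d); rewrite h; lia.
  rewrite exchange_big_nat /=; apply: eq_bigr => d _.
  rewrite exchange_big_nat /=; apply: eq_bigr => e _.
  by rewrite (sumR_pred1 _ _ (fun n => a d * b e * z n)).
have lim0 : is_lim_seq (fun N => A * B * exp (- k * ln (INR N))) 0.
  have -> : Rbar.Finite 0 = Rbar_mult (Rbar.Finite (A * B)) (Rbar.Finite 0) by rewrite /= Rmult_0_r.
  exact: is_lim_seq_scal_l (exp_ln_lim0 k0).
apply: (is_lim_seq_le_le_loc (fun N => - (A * B * exp (- k * ln (INR N)))) _ (fun N => A * B * exp (- k * ln (INR N)))) => //; last first.
  by have /is_lim_seq_opp /= := lim0; rewrite Ropp_0.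
exists 1%N => N /leP N1; apply/Rabs_le_between; rewrite E -sumR_sub.
apply: Rle_trans (sumR_abs _ _ _) _.
apply: (@Rle_trans _ (\sum_(0 <= d < N) \sum_(0 <= e < N)
  (exp (- k * ln (INR N)) * (Rabs (a d) * nps (1 + k) d * (Rabs (b e) * nps (1 + k) e))))).
  apply: sumR_le => d _; rewrite -sumR_sub; apply: Rle_trans (sumR_abs _ _ _) _.
  apply: sumR_le => e _.
  have P : 0 <= exp (- k * ln (INR N)) * (Rabs (a d) * nps (1 + k) d * (Rabs (b e) * nps (1 + k) e)).
    have := exp_pos (- k * ln (INR N)); have := Rabs_pos (a d); have := Rabs_pos (b e).
    have := nps_ge0 (1 + k) d; have := nps_ge0 (1 + k) e => h1 h2 h3 h4 h5.
    apply: Rmult_le_pos; first lra; apply: Rmult_le_pos; exact: Rmult_le_pos.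
  case: ltnP => de; first by rewrite Rminus_diag Rabs_R0.
  rewrite Rminus_0_r !Rabs_mult.
  have de0 : (0 < d * e)%N by lia.
  have -> : exp (- k * ln (INR N)) * (Rabs (a d) * nps (1 + k) d * (Rabs (b e) * nps (1 + k) e)) =
    Rabs (a d) * Rabs (b e) * (exp (- k * ln (INR N)) * nps (1 + k) (d * e)%N).
    by rewrite nps_mul; ring.
  apply: Rmult_le_compat_l; first by apply: Rmult_le_pos; exact: Rabs_pos.
  (* Since s = 1 + 2 k and d e >= N, (d e)^(-s) <= N^(-k) (d e)^(-(1+k)): one [k] gives the decay,
     the other keeps both series convergent. *)
  apply: Rle_trans (hz _) _; rewrite !nps_gt0 //.
  rewrite -exp_plus; set v := ln (INR (d * e)%N).
  have : ln (INR N) <= v by apply: ln_le; [exact: INR_gt0 | apply: le_INR; lia].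
  move=> hv; apply: exp_mono.
  have -> : s = 1 + 2 * k by rewrite /k; field.
  nra.
have -> : \sum_(0 <= d < N) \sum_(0 <= e < N)
  (exp (- k * ln (INR N)) * (Rabs (a d) * nps (1 + k) d * (Rabs (b e) * nps (1 + k) e))) =
  exp (- k * ln (INR N)) * ((\sum_(0 <= d < N) (Rabs (a d) * nps (1 + k) d)) *
   (\sum_(0 <= e < N) (Rabs (b e) * nps (1 + k) e))).
  rewrite sumR_mul big_distrr /=; apply: eq_bigr => d _; by rewrite big_distrr.
rewrite Rmult_comm; apply: Rmult_le_compat_r; first exact/Rlt_le/exp_pos.
apply: Rmult_le_compat => //; apply: sumR_ge0 => i _; apply: Rmult_le_pos;
  by [exact: Rabs_pos | exact: nps_ge0].
Qed.

Lemma lim_seq_eq (u v : nat -> R) (l m : R) : is_lim_seq u l -> is_lim_seq v m ->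
  (forall n, u n = v n) -> l = m.
Proof.
move=> hu hv e; have := is_lim_seq_unique _ _ hu; rewrite (Lim_seq_ext _ _ e).
by rewrite (is_lim_seq_unique _ _ hv) => -[].
Qed.

(** By the addition formulas, the products of partial sums are the box sums of [conv_lim], with z =
    [dcos] for the real part and z = [dsin] for the imaginary part. *)
Lemma Dir_conv a b s t : adm a -> adm b -> adm (conv a b) -> 1 < s ->
  (Dir a s t * Dir b s t)%C = Dir (conv a b) s t.
Proof.
move=> ha hb hc s1.
have ac := is_lim_seq_sum (ex_dcos t ha s1); have as_ := is_lim_seq_sum (ex_dsin t ha s1).
have bc := is_lim_seq_sum (ex_dcos t hb s1); have bs := is_lim_seq_sum (ex_dsin t hb s1).
have cc := is_lim_seq_sum (ex_dcos t hc s1); have cs := is_lim_seq_sum (ex_dsin t hc s1).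
have K (x y : R) : x - y + y = x by ring.
rewrite /Dir /Cmult /=; congr (_, _).
  have h1 := is_lim_seq_plus' _ _ _ _ (conv_lim ha hb s1 (dcos_abs s t)) cc.
  have h2 := is_lim_seq_minus' _ _ _ _ (is_lim_seq_mult' _ _ _ _ ac bc) (is_lim_seq_mult' _ _ _ _ as_ bs).
  rewrite Rmult_opp_opp -[RHS]Rplus_0_l; apply: (lim_seq_eq h2 h1) => N.
  rewrite K !sumR_mul -sumR_sub.
  apply: eq_bigr => d _; rewrite -sumR_sub; apply: eq_bigr => e _; rewrite dcos_mul; ring.
have h1 := is_lim_seq_plus' _ _ _ _ (conv_lim ha hb s1 (dsin_abs s t)) cs.
have h2 := is_lim_seq_plus' _ _ _ _ (is_lim_seq_mult' _ _ _ _ as_ bc) (is_lim_seq_mult' _ _ _ _ ac bs).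
rewrite -[in RHS](Rplus_0_l (Series _)) -(lim_seq_eq h2 h1); first by ring.
move=> N; rewrite K !sumR_mul -big_split /=.
apply: eq_bigr => d _; rewrite -big_split; apply: eq_bigr => e _; rewrite dsin_mul /=; ring.
Qed.

(** * The 3-4-1 inequality *)

(** A weight [ln n] stands for - d/ds. Hence [zeta1] is -zeta', [zeta2] is zeta'', [LA] is
    -zeta'/zeta and [LB] is (zeta'/zeta)', all at s + it. *)
Definition zeta (s t : R) : C := Dir (fun=> 1) s t.
Definition zeta1 (s t : R) : C := Dir (fun n => ln (INR n)) s t.
Definition zeta2 (s t : R) : C := Dir (fun n => ln (INR n) ^ 2) s t.
Definition LA (s t : R) : C := Dir vonM s t.
Definition LB (s t : R) : C := Dir (fun n => vonM n * ln (INR n)) s t.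

(** The convolution identities hold only for n > 0; the value at 0 is absorbed into the constant. *)
Lemma adm_le_pos (a b : nat -> R) : adm b ->
  (forall n, (0 < n)%N -> Rabs (a n) <= Rabs (b n)) -> adm a.
Proof.
move=> [K K0 h] hab; have a0 := Rabs_pos (a 0%N); exists (K + Rabs (a 0%N)); first lra.
move=> [|n].
  have := pow_R1_Rle (1 + ln (INR 0)) 2; have := ln_INR_ge0 0 => l0 h1.
  have : 1 <= (1 + ln (INR 0)) ^ 2 by apply: h1; lra.
  nra.
apply: Rle_trans (hab _ (ltn0Sn n)) _; apply: Rle_trans (h _) _.
have := pow2_ge_0 (1 + ln (INR n.+1)); nra.
Qed.

Lemma conv_ge0 a b n : (forall n, 0 <= a n) -> (forall n, 0 <= b n) -> 0 <= conv a b n.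
Proof.
move=> ha hb; apply: sumR_ge0 => i _; apply: sumR_ge0 => j _.
case: ifP => _; [exact: Rmult_le_pos | lra].
Qed.

Lemma LA_zeta s t : 1 < s -> (LA s t * zeta s t)%C = zeta1 s t.
Proof.
move=> s1; rewrite /LA /zeta Dir_conv //; [|exact: adm_vonM|exact: adm_1|].
  by apply: Dir_ext => n; exact: conv_vonM1.
by apply: adm_le_pos adm_ln _ => n n0; rewrite conv_vonM1 //; lra.
Qed.

Lemma LB_zeta s t : 1 < s -> (LB s t * zeta s t + LA s t * zeta1 s t)%C = zeta2 s t.
Proof.
move=> s1.
have p1 n : 0 <= conv (fun d => vonM d * ln (INR d)) (fun _ => 1) n.
  apply: conv_ge0 => m; [|lra]; apply: Rmult_le_pos; [exact: vonM_ge0 | exact: ln_INR_ge0].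
have p2 n : 0 <= conv vonM (fun d => ln (INR d)) n.
  by apply: conv_ge0 => m; [exact: vonM_ge0 | exact: ln_INR_ge0].
have a1 : adm (conv (fun d => vonM d * ln (INR d)) (fun _ => 1)).
  apply: adm_le_pos adm_ln2 _ => n n0; have := conv_vonM_ln2 n0; have := p1 n; have := p2 n => h1 h2 h3.
  rewrite !Rabs_pos_eq; nra.
have a2 : adm (conv vonM (fun d => ln (INR d))).
  apply: adm_le_pos adm_ln2 _ => n n0; have := conv_vonM_ln2 n0; have := p1 n; have := p2 n => h1 h2 h3.
  rewrite !Rabs_pos_eq; nra.
rewrite /LA /zeta /LB /zeta1 !Dir_conv //; try exact: adm_vonM; try exact: adm_1;
  try exact: adm_ln; try exact: adm_vonM_ln.
rewrite (@Dir_ext (conv vonM (fun d => ln (INR d))) (fun n => ln (INR n) ^ 2 -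
  conv (fun d => vonM d * ln (INR d)) (fun _ => 1) n)); last first.
  by move=> n n0; rewrite -(conv_vonM_ln2 n0); ring.
rewrite Dir_sub //; last exact: adm_ln2.
by rewrite -/(zeta2 s t); ring.
Qed.

(** * Differentiation of Dirichlet series in s *)

Lemma exp_quad x : Rabs (exp x - 1 - x) <= x ^ 2 * exp (Rabs x).
Proof.
have h1 := exp_ge_lin x; have h2 := exp_ge_lin (- x); have p := exp_pos x.
have e : exp x * exp (- x) = 1 by rewrite -exp_plus Rplus_opp_r exp_0.
rewrite Rabs_pos_eq; last lra.
have h3 : exp x - 1 <= x * exp x by have := Rmult_le_compat_r _ _ _ (Rlt_le _ _ p) h2; lra.
case: (Rle_lt_dec 0 x) => hx.
  rewrite Rabs_pos_eq //.
  have : x * (exp x - 1) <= x * (x * exp x) by apply: Rmult_le_compat_l.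
  lra.
rewrite Rabs_left //.
have h4 : - x * (1 - exp x) <= - x * - x by apply: Rmult_le_compat_l; lra.
have h5 : x ^ 2 * 1 <= x ^ 2 * exp (- x) by apply: Rmult_le_compat_l; [exact: pow2_ge_0 | lra].
lra.
Qed.

Lemma is_derive_quad (f : R -> R) x l K r : 0 < r ->
  (forall h, Rabs h <= r -> Rabs (f (x + h) - f x - l * h) <= K * h ^ 2) -> is_derive f x l.
Proof.
move=> r0 hf; apply/is_derive_Reals => e e0.
have K0 : 0 < Rabs K + 1 by have := Rabs_pos K; lra.
have d0 : 0 < Rmin r (e / (Rabs K + 1)) by apply: Rmin_pos => //; exact: Rdiv_lt_0_compat.
exists (mkposreal _ d0) => h h0 /= hd.
have h1 : Rabs h < r := Rlt_le_trans _ _ _ hd (Rmin_l _ _).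
have h2 : Rabs h < e / (Rabs K + 1) := Rlt_le_trans _ _ _ hd (Rmin_r _ _).
have ah := Rabs_pos_lt _ h0.
rewrite (_ : (f (x + h) - f x) / h - l = (f (x + h) - f x - l * h) / h); last by field.
rewrite Rabs_div //; apply: (Rmult_lt_reg_r (Rabs h)) => //.
rewrite /Rdiv Rmult_assoc Rinv_l ?Rmult_1_r; last by lra.
apply: Rle_lt_trans (hf h (Rlt_le _ _ h1)) _.
apply: (@Rle_lt_trans _ ((Rabs K + 1) * Rabs h * Rabs h)).
  have := Rle_abs K; have := pow2_ge_0 h; rewrite -(pow2_abs h); nra.
apply: Rmult_lt_compat_r => //.
apply: (Rmult_lt_reg_r (/ (Rabs K + 1))); first exact: Rinv_0_lt_compat.
rewrite Rmult_comm -Rmult_assoc Rinv_l; last lra.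
by rewrite Rmult_1_l.
Qed.

Lemma is_derive_eq (f : R -> R) (x l l' : R) : is_derive f x l -> l = l' -> is_derive f x l'.
Proof. by move=> h <-. Qed.

Lemma Series_derive (c : nat -> R) s : (forall n, Rabs (c n) <= 1) -> 1 < s ->
  is_derive (fun s => Series (fun n => c n * nps s n)) s
    (- Series (fun n => c n * ln (INR n) * nps s n)).
Proof.
(* For |h| <= r the second-order remainder of each term is at most h^2 (ln n)^2 n^(-(s-r)), and s -
   r is still above 1. *)
move=> hc s1; pose r := (s - 1) / 2; have r0 : 0 < r by rewrite /r; lra.
have ac : adm c by apply: adm_le adm_1 _ => n; rewrite Rabs_R1.
have acl : adm (fun n => c n * ln (INR n)).
  apply: adm_le adm_ln _ => n; rewrite Rabs_mult; have := Rabs_pos (ln (INR n)); have := hc n; nra.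
have ex (a : nat -> R) s' : adm a -> 1 < s' -> ex_series (fun n => a n * nps s' n).
  move=> ha hs'; apply: ex_series_dom (adm_summable ha hs') => n.
  by rewrite Rabs_mult (Rabs_pos_eq _ (nps_ge0 _ _)); lra.
have sr : 1 < s - r by rewrite /r; lra.
have hK := adm_summable adm_ln2 sr.
have /= [M hM] := adm_sum_bound adm_ln2 sr.
apply: (is_derive_quad (K := M) r0) => h hr.
have sh : 1 < s + h by have := Rcomplements.Rabs_le_between h r; rewrite /r in hr sr *; move=> [/(_ hr)]; lra.
have e : Series (fun n => c n * nps (s + h) n) - Series (fun n => c n * nps s n)
  - (- Series (fun n => c n * ln (INR n) * nps s n)) * h =
  Series (fun n => c n * (nps (s + h) n - nps s n + h * ln (INR n) * nps s n)).
  transitivity (Series (fun n => c n * nps (s + h) n) - Series (fun n => c n * nps s n)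
    + h * Series (fun n => c n * ln (INR n) * nps s n)); first by ring.
  rewrite -Series_scal_l -Series_minus; [|exact: ex|exact: ex].
  rewrite -Series_plus.
  - by apply: Series_ext => n; ring.
  - by apply: (@ex_series_minus _ R_NormedModule); exact: ex.
  - by apply: (@ex_series_scal _ R_NormedModule); exact: ex.
rewrite e.
have [] // := @Series_abs_bound (fun n => c n * (nps (s + h) n - nps s n + h * ln (INR n) * nps s n))
  (fun n => h ^ 2 * (Rabs (ln (INR n) ^ 2) * nps (s - r) n)) (M * h ^ 2).
- move=> n; rewrite Rabs_mult -[X in _ <= X]Rmult_1_l.
  apply: Rmult_le_compat => //; try exact: Rabs_pos.
  case: n => [|n].
    by rewrite /= !Rmult_0_r Rminus_0_r Rplus_0_r Rabs_R0; lra.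
  rewrite !nps_gt0 //; set v := ln _; have v0 : 0 <= v := ln_INR_ge0 _.
  rewrite (Rabs_pos_eq (v ^ 2)); last exact: pow2_ge_0.
  have -> : exp (- (s + h) * v) = exp (- s * v) * exp (- h * v).
    by rewrite -exp_plus; congr exp; ring.
  have -> : exp (- s * v) * exp (- h * v) - exp (- s * v) + h * v * exp (- s * v) =
     exp (- s * v) * (exp (- h * v) - 1 - (- h * v)) by ring.
  rewrite Rabs_mult (Rabs_pos_eq (exp _)); last exact/Rlt_le/exp_pos.
  apply: Rle_trans (Rmult_le_compat_l _ _ _ (Rlt_le _ _ (exp_pos _)) (exp_quad _)) _.
  have -> : exp (- s * v) * ((- h * v) ^ 2 * exp (Rabs (- h * v))) =
    h ^ 2 * (v ^ 2 * (exp (- s * v) * exp (Rabs (- h * v)))) by ring.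
  do 2 (apply: Rmult_le_compat_l; first exact: pow2_ge_0).
  rewrite -exp_plus Rabs_mult Rabs_Ropp (Rabs_pos_eq v) //.
  by apply: exp_mono; nra.
- move=> N; rewrite -big_distrr /= Rmult_comm; apply: Rmult_le_compat_r; [exact: pow2_ge_0 | exact: hM].
Qed.

Lemma zeta_derive_re s t : 1 < s ->
  is_derive (fun s => fst (zeta s t)) s (- fst (zeta1 s t)).
Proof.
move=> s1; rewrite /zeta /zeta1 /=.
apply: (is_derive_ext (fun s => Series (fun n => cos (t * ln (INR n)) * nps s n))).
  by move=> s'; apply: Series_ext => n; rewrite /dcos; ring.
have -> : Series (fun n => ln (INR n) * dcos s t n) =
          Series (fun n => cos (t * ln (INR n)) * ln (INR n) * nps s n).
  by apply: Series_ext => n; rewrite /dcos; ring.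
by apply: Series_derive => // n; apply: Rabs_le; exact: COS_bound.
Qed.

Lemma zeta_derive_im s t : 1 < s ->
  is_derive (fun s => snd (zeta s t)) s (- snd (zeta1 s t)).
Proof.
move=> s1; rewrite /zeta /zeta1 /=.
apply: (is_derive_ext (fun s => - Series (fun n => sin (t * ln (INR n)) * nps s n))).
  by move=> s'; congr (- _); apply: Series_ext => n; rewrite /dsin; ring.
have -> : Series (fun n => ln (INR n) * dsin s t n) =
          Series (fun n => sin (t * ln (INR n)) * ln (INR n) * nps s n).
  by apply: Series_ext => n; rewrite /dsin; ring.
apply: (@is_derive_opp _ R_NormedModule).
by apply: Series_derive => // n; apply: Rabs_le; exact: SIN_bound.
Qed.

(** The squared modulus is polynomial in the two parts of zeta, hence differentiable in [s] without
    knowing that zeta does not vanish. *)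
Definition zsq (s t : R) : R := fst (zeta s t) ^ 2 + snd (zeta s t) ^ 2.

Lemma zsq_ge0 s t : 0 <= zsq s t.
Proof. by rewrite /zsq; have := pow2_ge_0 (fst (zeta s t)); have := pow2_ge_0 (snd (zeta s t)); lra. Qed.

Lemma zsq_Cmod s t : zsq s t = Cmod (zeta s t) ^ 2.
Proof. by rewrite /Cmod pow2_sqrt //; exact: zsq_ge0. Qed.

Lemma zsq_derive s t : 1 < s ->
  is_derive (fun s => zsq s t) s (- 2 * zsq s t * fst (LA s t)).
Proof.
move=> s1; have dr := zeta_derive_re t s1; have di := zeta_derive_im t s1.
have dr2 := is_derive_mult _ _ _ _ _ dr dr Rmult_comm.
have di2 := is_derive_mult _ _ _ _ _ di di Rmult_comm.
have d := is_derive_plus _ _ _ _ _ dr2 di2.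
apply: (is_derive_ext (fun s => plus (fst (zeta s t) * fst (zeta s t)) (snd (zeta s t) * snd (zeta s t)))).
  by move=> s'; rewrite /zsq /plus /=; ring.
apply: (is_derive_eq d).
rewrite -(LA_zeta t s1) /zsq; case: (LA s t) => ar ai; case: (zeta s t) => x y /=.
by rewrite /plus /mult /=; ring.
Qed.

Lemma Series_ge0 (a : nat -> R) : (forall n, 0 <= a n) -> ex_series a -> 0 <= Series a.
Proof. by move=> h0 h; have := sum_le_Series 0 h0 h; rewrite big_nil. Qed.

(** Termwise, 3 + 4 cos a + cos 2a = 2 (1 + cos a)^2 and Lambda >= 0. *)
Lemma LA_341 s t : 1 < s ->
  0 <= 3 * fst (LA s 0) + 4 * fst (LA s t) + fst (LA s (2 * t)).
Proof.
move=> s1; rewrite /LA /= -!Series_scal_l.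
have E u := ex_dcos u adm_vonM s1.
have ES k u : ex_series (fun n => k * (vonM n * dcos s u n)).
  by apply: (@ex_series_scal _ R_NormedModule); exact: E.
rewrite -!Series_plus //; last by apply: (@ex_series_plus _ R_NormedModule); exact: ES.
apply: Series_ge0; last first.
  apply: (@ex_series_plus _ R_NormedModule) => //; apply: (@ex_series_plus _ R_NormedModule); exact: ES.
move=> n; rewrite /dcos; set v := ln _; rewrite Rmult_0_l cos_0 Rmult_assoc cos_2a_cos.
set x := cos (t * v).
have -> : 3 * (vonM n * (nps s n * 1)) + 4 * (vonM n * (nps s n * x)) +
  vonM n * (nps s n * (2 * x * x - 1)) = vonM n * (nps s n * (2 * (1 + x) ^ 2)) by ring.
have := vonM_ge0 n; have := nps_ge0 s n; have := pow2_ge_0 (1 + x) => h1 h2 h3.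
apply: Rmult_le_pos => //; apply: Rmult_le_pos => //; lra.
Qed.

(** The product has derivative -2 times itself times the 3-4-1 combination of [LA], so it decreases
    in [s]. Comparison with s = 3, where zeta is visibly bounded below, avoids both the logarithm of
    zeta and the Euler product. *)
Lemma zsq_341 s t : 1 < s <= 3 ->
  zsq 3 0 ^ 3 * zsq 3 t ^ 4 * zsq 3 (2 * t) <= zsq s 0 ^ 3 * zsq s t ^ 4 * zsq s (2 * t).
Proof.
move=> [s1 s3]; pose W s := zsq s 0 ^ 3 * zsq s t ^ 4 * zsq s (2 * t).
pose dW s := - 2 * W s * (3 * fst (LA s 0) + 4 * fst (LA s t) + fst (LA s (2 * t))).
have D x : 1 < x -> is_derive W x (dW x).
  move=> x1; have d0 := zsq_derive 0 x1; have d1 := zsq_derive t x1; have d2 := zsq_derive (2 * t) x1.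
  have p0 := is_derive_pow _ 3 _ _ d0; have p1 := is_derive_pow _ 4 _ _ d1.
  have m1 := is_derive_mult _ _ _ _ _ p0 p1 Rmult_comm.
  have m2 := is_derive_mult _ _ _ _ _ m1 d2 Rmult_comm.
  apply: (is_derive_eq m2).
  by rewrite /dW /W /plus /mult /=; ring.
case: (Rle_lt_or_eq_dec _ _ s3) => [lt3|->]; last lra.
have [|x hx|c [hc e]] := @MVT_gen W s 3 dW.
- by move=> x hx; apply: D; rewrite Rmin_left in hx; lra.
- apply/continuity_pt_filterlim/(@ex_derive_continuous _ R_NormedModule); exists (dW x); apply: D.
  by rewrite Rmin_left in hx; lra.
rewrite Rmin_left // Rmax_right // in hc.
have h := @LA_341 c t ltac:(lra).
have W0 : 0 <= W c.
  apply: Rmult_le_pos (zsq_ge0 _ _); apply: Rmult_le_pos; apply: pow_le; exact: zsq_ge0.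
have : dW c <= 0 by rewrite /dW; nra.
rewrite -/(W s) -/(W 3); nra.
Qed.

(** The term n = 1 is 1 and the others have total modulus at most 1/2, since the sum of n^(-3) is at
    most 3/2. *)
Lemma zsq3_ge t : / 4 <= zsq 3 t.
Proof.
have s1 : 1 < 3 by lra.
have [||_ hs] := @Series_abs_bound (nps 3) (nps 3) (1 + / 2).
- by move=> n; rewrite Rabs_pos_eq; [lra | exact: nps_ge0].
- by move=> N; have -> : 3 = 1 + 2 by [lra]; apply: sum_nps_bound; lra.
have ex : ex_series (nps 3).
  apply: ex_series_dom (adm_summable adm_1 s1) => n.
  by rewrite Rabs_R1 Rmult_1_l Rabs_pos_eq; [lra | exact: nps_ge0].
have := @Series_tail (fun n => 1 * dcos 3 t n) (nps 3) 2 _ ex.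
rewrite !sumR_recr !big_nil /dcos /= ln_1 !Rmult_0_r cos_0 exp_0.
have := Rle_abs (Series (nps 3)) => h1 h2.
have : fst (zeta 3 t) >= / 2.
  have /h2 : forall n, Rabs (1 * dcos 3 t n) <= nps 3 n by move=> n; rewrite Rmult_1_l; exact: dcos_abs.
  rewrite /zeta /= /dcos; set S := Series _ => /Rabs_le_between; lra.
by rewrite /zsq; have := pow2_ge_0 (snd (zeta 3 t)); nra.
Qed.

Lemma zsq_real_le s : 1 < s <= 2 -> zsq s 0 <= (2 / (s - 1)) ^ 2.
Proof.
move=> [s1 s2].
have i0 : 0 < / (s - 1) by apply: Rinv_0_lt_compat; lra.
have i1 : 1 <= / (s - 1) by rewrite -Rinv_1; apply: Rinv_le_contravar; lra.
have e0 : snd (zeta s 0) = 0.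
  rewrite /zeta /= (Series_ext _ (fun=> 0 * 0)); first by rewrite Series_scal_l; ring.
  by move=> n; rewrite /dsin Rmult_0_l sin_0; ring.
have [||_] := @Series_abs_bound (fun n => 1 * dcos s 0 n) (nps s) (1 + / (s - 1)).
- by move=> n; rewrite Rmult_1_l; exact: dcos_abs.
- by move=> N; have {1}-> : s = 1 + (s - 1) by [lra]; apply: sum_nps_bound; lra.
rewrite /zsq e0 -[Series _]/(fst (zeta s 0)) => h.
rewrite (_ : 0 ^ 2 = 0); last by ring.
rewrite Rplus_0_r -pow2_abs; apply: pow_incr; split; first exact: Rabs_pos.
by apply: Rle_trans h _; rewrite /Rdiv; lra.
Qed.

Lemma Cmod_le_sum (z : C) : Cmod z <= Rabs (fst z) + Rabs (snd z).
Proof.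
case: z => x y /=; have -> : ((x, y) : C) = ((x, 0) + (0, y))%C by rewrite /Cplus /= Rplus_0_l Rplus_0_r.
apply: Rle_trans (Cmod_triangle _ _) _; rewrite /Cmod /=.
have e u : u * (u * 1) + 0 * (0 * 1) = Rsqr u by rewrite /Rsqr; ring.
have e' u : 0 * (0 * 1) + u * (u * 1) = Rsqr u by rewrite /Rsqr; ring.
by rewrite e e' !sqrt_Rsqr_abs; lra.
Qed.

Lemma Cmod_re (z : C) : Rabs (fst z) <= Cmod z.
Proof. by apply: Rle_trans (Rmax_l _ _) (Rmax_Cmod z). Qed.

Lemma Cmod_im (z : C) : Rabs (snd z) <= Cmod z.
Proof. by apply: Rle_trans (Rmax_r _ _) (Rmax_Cmod z). Qed.

Lemma MVT_bound (f df : R -> R) a b M : a <= b ->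
  (forall x, a <= x <= b -> is_derive f x (df x)) ->
  (forall x, a <= x <= b -> Rabs (df x) <= M) -> Rabs (f b - f a) <= M * (b - a).
Proof.
move=> ab hd hM.
have [|x hx|c [hc ->]] := @MVT_gen f a b df.
- by move=> x hx; apply: hd; rewrite Rmin_left // Rmax_right // in hx; lra.
- apply/continuity_pt_filterlim/(@ex_derive_continuous _ R_NormedModule); exists (df x); apply: hd.
  by rewrite Rmin_left // Rmax_right // in hx.
rewrite Rmin_left // Rmax_right // in hc.
rewrite Rabs_mult (Rabs_pos_eq (b - a)); last lra.
by apply: Rmult_le_compat_r; [lra | exact: hM].
Qed.

(* At [s1 = 1 + k] the 3-4-1 inequality gives [|zeta|^8 >= 2^(-22) k^6 / M^2], which equals
   [(4 k M)^8]; to the left of [s1], [zeta] moves by at most [2 k M]. *)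
Lemma zeta_lower M t : 1 <= M ->
  (forall s, 1 < s <= 2 -> Cmod (zeta s t) <= M /\ Cmod (zeta s (2 * t)) <= M /\ Cmod (zeta1 s t) <= M) ->
  forall s, 1 < s <= 2 -> / (2 ^ 18 * M ^ 4) <= Cmod (zeta s t).
Proof.
move=> M1 hM; pose k := / (2 ^ 19 * M ^ 5).
have M4 : 1 <= M ^ 4 by apply: pow_R1_Rle.
have M5 : 1 <= M ^ 5 by apply: pow_R1_Rle.
have k0 : 0 < k by apply: Rinv_0_lt_compat; lra.
have k1 : k < 1 by rewrite /k -Rinv_1; apply: Rinv_lt_contravar; lra.
(* Half of 4 k M is exactly the claimed bound; this half survives the displacement 2 k M on the way
   down from 1 + k. *)
have ek : 4 * k * M = 2 * / (2 ^ 18 * M ^ 4) by rewrite /k; field; lra.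
have far s : 1 + k <= s <= 2 -> 4 * k * M <= Cmod (zeta s t).
  move=> hs; have s1 : 1 < s <= 2 by lra.
  have [h1 [h2 _]] := hM s s1.
  have h3 := @zsq_341 s t ltac:(lra).
  have q0 := zsq3_ge 0; have q1 := zsq3_ge t; have q2 := zsq3_ge (2 * t).
  have l : (/ 4) ^ 8 <= zsq s 0 ^ 3 * zsq s t ^ 4 * zsq s (2 * t).
    apply: Rle_trans h3; rewrite (_ : (/ 4) ^ 8 = (/ 4) ^ 3 * (/ 4) ^ 4 * (/ 4)); last by field.
    have p u : 0 <= zsq 3 u ^ 3 /\ 0 <= zsq 3 u ^ 4 by split; apply: pow_le; exact: zsq_ge0.
    have pw n u : (/ 4) ^ n <= zsq 3 u ^ n by apply: pow_incr; split; [lra | exact: zsq3_ge].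
    have p4 n : 0 <= (/ 4) ^ n by apply: pow_le; lra.
    apply: Rmult_le_compat => //; [by apply: Rmult_le_pos | lra|].
    by apply: Rmult_le_compat.
  set r := Cmod (zeta s t) in h1 *; have r0 : 0 <= r := Cmod_ge_0 _.
  have z2 : zsq s (2 * t) <= M ^ 2.
    by rewrite zsq_Cmod; apply: pow_incr; split=> //; exact: Cmod_ge_0.
  have z0 : zsq s 0 <= (2 / k) ^ 2.
    apply: Rle_trans (zsq_real_le s1) _; apply: pow_incr; split.
      by apply: Rlt_le; apply: Rdiv_lt_0_compat; lra.
    by apply: Rmult_le_compat_l; [lra | apply: Rinv_le_contravar; lra].
  have z03 : zsq s 0 ^ 3 <= ((2 / k) ^ 2) ^ 3 by apply: pow_incr; split=> //; exact: zsq_ge0.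
  have {}l : (/ 4) ^ 8 <= ((2 / k) ^ 2) ^ 3 * r ^ 8 * M ^ 2.
    apply: Rle_trans l _.
    have p0 : 0 <= zsq s 0 ^ 3 by apply: pow_le; exact: zsq_ge0.
    have -> : zsq s t ^ 4 = r ^ 8 by rewrite zsq_Cmod -/r; ring.
    have r8 : 0 <= r ^ 8 by apply: pow_le.
    apply: Rmult_le_compat => //; first by apply: Rmult_le_pos.
      exact: zsq_ge0.
    by apply: Rmult_le_compat_r.
  have {}l : (4 * k * M) ^ 8 <= r ^ 8.
    have k6 : 0 < k ^ 6 / (2 ^ 6 * M ^ 2).
      apply: Rdiv_lt_0_compat; first exact: pow_lt.
      have : 0 < M ^ 2 by apply: pow_lt; lra.
      lra.
    have := Rmult_le_compat_l _ _ _ (Rlt_le _ _ k6) l.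
    have -> : k ^ 6 / (2 ^ 6 * M ^ 2) * (((2 / k) ^ 2) ^ 3 * r ^ 8 * M ^ 2) = r ^ 8.
      by field; split; lra.
    have -> : k ^ 6 / (2 ^ 6 * M ^ 2) * (/ 4) ^ 8 = (4 * k * M) ^ 8; last by [].
    by rewrite /k; field; lra.
  case: (Rle_lt_dec (4 * k * M) r) => // hlt; exfalso.
  have a7 : 0 < (4 * k * M) ^ 7 by apply: pow_lt; lra.
  have r7 : r ^ 7 <= (4 * k * M) ^ 7 by apply: pow_incr; lra.
  move: l; rewrite -[(4 * k * M) ^ 8]/(4 * k * M * (4 * k * M) ^ 7) -[r ^ 8]/(r * r ^ 7); nra.
move=> s [s1 s2]; have i0 : 0 < / (2 ^ 18 * M ^ 4) by apply: Rinv_0_lt_compat; lra.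
case: (Rle_lt_dec (1 + k) s) => hs.
  by have := far s (conj hs s2); lra.
have f1 := far (1 + k) ltac:(lra).
have in12 x : s <= x <= 1 + k -> 1 < x <= 2 by lra.
have dr : Rabs (fst (zeta (1 + k) t) - fst (zeta s t)) <= M * (1 + k - s).
  apply: (@MVT_bound (fun x => fst (zeta x t)) (fun x => - fst (zeta1 x t))); first lra.
    by move=> x hx; apply: zeta_derive_re; lra.
  move=> x hx; rewrite Rabs_Ropp; apply: Rle_trans (Cmod_re _) _.
  by have [_ []] := hM x (in12 x hx).
have di : Rabs (snd (zeta (1 + k) t) - snd (zeta s t)) <= M * (1 + k - s).
  apply: (@MVT_bound (fun x => snd (zeta x t)) (fun x => - snd (zeta1 x t))); first lra.
    by move=> x hx; apply: zeta_derive_im; lra.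
  move=> x hx; rewrite Rabs_Ropp; apply: Rle_trans (Cmod_im _) _.
  by have [_ []] := hM x (in12 x hx).
have tri : Cmod (zeta (1 + k) t) <= Cmod (zeta s t) + Cmod (zeta (1 + k) t - zeta s t)%C.
  have {1}-> : zeta (1 + k) t = (zeta s t + (zeta (1 + k) t - zeta s t))%C by ring.
  exact: Cmod_triangle.
have h : Cmod (zeta (1 + k) t - zeta s t)%C <= Rabs (fst (zeta (1 + k) t) - fst (zeta s t)) +
  Rabs (snd (zeta (1 + k) t) - snd (zeta s t)) := Cmod_le_sum _.
have : M * (1 + k - s) <= M * k by apply: Rmult_le_compat_l; lra.
lra.
Qed.

(** * Behaviour near the pole and growth in [t] *)

(** Interpolation between a trivial bound and a derivative bound, which is better by T e^(-v) up to
    a constant. Taking the first for v <= ln T and the second beyond it costs (T e^(-v))^c. A part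
    e^(c v / 2) of this gain pays for the logarithms, and the rest makes the sum over n converge to
    O(T^c). The constant 16 is 4 times the 4 in (1 + w)^2 <= 4 (1 + v)^2. *)
Lemma gterm_bound c C v w T : 0 < c <= 1 -> 1 <= T -> 0 <= v -> v <= w <= v + 1 ->
  (forall v, 0 <= v -> (1 + v) ^ 2 <= C * exp (c / 2 * v)) -> forall x,
  Rabs x <= 2 * ((1 + w) ^ 2 * exp (- v)) -> Rabs x <= 4 * T * ((1 + w) ^ 2 * exp (- v) * exp (- v)) ->
  Rabs x <= 16 * C * exp (c * ln T) * exp (- (1 + c / 2) * v).
Proof.
move=> [c0 c1] T1 v0 hw hC x h1 h2.
have ev := exp_pos (- v); set L := (1 + w) ^ 2 in h1 h2.
have L0 : 0 <= L := pow2_ge_0 _.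
have hL : L <= 4 * (C * exp (c / 2 * v)).
  by apply: Rle_trans (Rmult_le_compat_l 4 _ _ ltac:(lra) (hC v v0)); rewrite /L; nra.
have {h1 h2} h : Rabs x <= 4 * (L * exp (- v)) * exp (c * (ln T - v)).
  have P : 0 <= L * exp (- v) by apply: Rmult_le_pos; lra.
  case: (Rle_lt_dec v (ln T)) => hv.
    have : 1 <= exp (c * (ln T - v)) by have := exp_ge_lin (c * (ln T - v)); nra.
    nra.
  have e : T * exp (- v) = exp (ln T - v).
    by rewrite /Rminus exp_plus exp_ln //; lra.
  have : T * exp (- v) <= exp (c * (ln T - v)).
    by rewrite e; apply: exp_mono; nra.
  move: h2 P; set y := L * exp (- v); set z := exp (c * _) => h2 P h3.
  have -> : 4 * y * z = 4 * (y * z) by ring.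
  have : y * (T * exp (- v)) <= y * z by apply: Rmult_le_compat_l.
  by rewrite -/y in h2; lra.
apply: Rle_trans h _.
have -> : 16 * C * exp (c * ln T) * exp (- (1 + c / 2) * v) =
  4 * (4 * (C * exp (c / 2 * v)) * exp (- v)) * exp (c * (ln T - v)).
  have -> : exp (c * (ln T - v)) = exp (c * ln T) * exp (- c * v) by rewrite -exp_plus; congr exp; ring.
  have -> : exp (- (1 + c / 2) * v) = exp (c / 2 * v) * exp (- v) * exp (- c * v).
    by rewrite -!exp_plus; congr exp; field.
  ring.
apply: Rmult_le_compat_r; first exact/Rlt_le/exp_pos.
apply: Rmult_le_compat_l; first lra.
by apply: Rmult_le_compat_r; lra.
Qed.

(* Euler summation of [u |-> g (ln u) / u] against its antiderivative [- P (ln u)]. *)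
Lemma gsum_bound c : 0 < c <= 1 -> exists2 K, 0 < K & forall (g g' P : R -> R) (S T : R), 1 <= T ->
  (forall v, 0 <= v -> is_derive g v (g' v)) -> (forall v, 0 <= v -> is_derive P v (- g v)) ->
  (forall v, 0 <= v -> Rabs (g v) <= (1 + v) ^ 2) ->
  (forall v, 0 <= v -> Rabs (g' v) + Rabs (g v) <= 4 * T * (1 + v) ^ 2) ->
  is_lim_seq (fun N => P (ln (INR N.+1))) 0 ->
  is_lim_seq (fun N => \sum_(0 <= n < N) (g (ln (INR n.+1)) * / INR n.+1)) S ->
  Rabs (S - P 0) <= K * exp (c * ln T).
Proof.
move=> hc; have c2 : 0 < c / 2 by lra.
have [C C0 hC] := poly_exp c2.
have ic : 0 < / (c / 2) by apply: Rinv_0_lt_compat.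
exists (16 * C * (1 + / (c / 2))); first by apply: Rmult_lt_0_compat; lra.
move=> g g' P S T T1 dg dP bg bg' lP lS.
have lD : is_lim_seq (fun N => Rabs (\sum_(0 <= n < N) (g (ln (INR n.+1)) * / INR n.+1) +
   P (ln (INR N.+1)) - P 0)) (Rabs (S - P 0)).
  apply: (is_lim_seq_abs _ (Rbar.Finite (S - P 0))).
  have -> : S - P 0 = S + 0 - P 0 by ring.
  apply: is_lim_seq_minus'; last exact: is_lim_seq_const.
  exact: (is_lim_seq_plus' _ _ _ _ lS lP).
apply: (is_lim_seq_le _ _ _ _ _ lD (is_lim_seq_const _)) => N.
have e : \sum_(0 <= n < N) (g (ln (INR n.+1)) * / INR n.+1) + P (ln (INR N.+1)) - P 0 =
  \sum_(0 <= n < N) (g (ln (INR n.+1)) * / INR n.+1 + (P (ln (INR n.+2)) - P (ln (INR n.+1)))).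
  by rewrite big_split /= (sumR_telescope N (fun n => P (ln (INR n.+1)))) /= ln_1; ring.
rewrite e {e}; apply: Rle_trans (sumR_abs _ _ _) _.
apply: (@Rle_trans _ (\sum_(0 <= n < N) (16 * C * exp (c * ln T) * nps (1 + c / 2) n.+1))); last first.
  rewrite -big_distrr /=.
  have h := sum_nps_bound N.+1 c2.
  rewrite big_nat_recl //= Rplus_0_l in h.
  have -> : 16 * C * (1 + / (c / 2)) * exp (c * ln T) = 16 * C * exp (c * ln T) * (1 + / (c / 2)) by ring.
  apply: Rmult_le_compat_l h; apply: Rmult_le_pos; [lra | exact/Rlt_le/exp_pos].
apply: sumR_le => n _; rewrite nps_gt0 //.
have n0 := @INR_gt0 n.+1 isT; have eN : INR n.+2 = INR n.+1 + 1 by rewrite [LHS]S_INR.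
have st := @ln_step n.+1 isT.
set x := INR n.+1 in n0 eN st *; have x1 : 1 <= x := @INR_ge1 n.+1 isT.
rewrite eN in st *.
have ix : / x = exp (- ln x) by rewrite exp_Ropp exp_ln.
have lnx : 0 <= ln x by exact: ln_ge0.
have w1 : ln x <= ln (x + 1) <= ln x + 1.
  have : / x <= 1 by rewrite -Rinv_1; apply: Rinv_le_contravar; lra.
  have : 0 < / (x + 1) by apply: Rinv_0_lt_compat; lra.
  lra.
(* In the variable u the summand is [F] at an integer and [- F] is the derivative of P (ln u). By
   the mean value theorem each term becomes F x - F xi with xi in [x, x + 1], to be bounded by the
   size of [F] or by that of [F']. *)
pose F u := g (ln u) * / u; pose F' u := (g' (ln u) - g (ln u)) * / u * / u.
have dln u : 1 <= u -> is_derive ln u (/ u) by move=> hu; apply: is_derive_ln; lra.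
have dQ u : 1 <= u -> is_derive (fun u => P (ln u)) u (- F u).
  move=> hu; apply: (is_derive_eq (is_derive_comp _ _ _ _ _ (dP _ (ln_ge0 hu)) (dln u hu))).
  by rewrite /F /scal /= /mult /=; ring.
have dF u : 1 <= u -> is_derive F u (F' u).
  move=> hu.
  have d1 := is_derive_comp _ _ _ _ _ (dg _ (ln_ge0 hu)) (dln u hu).
  have d2 : is_derive Rinv u (- 1 / u ^ 2).
    by apply: is_derive_inv; [apply: is_derive_id | lra].
  apply: (is_derive_eq (is_derive_mult _ _ _ _ _ d1 d2 Rmult_comm)).
  by rewrite /F' /scal /plus /mult /= /mult /=; field; lra.
have mon u : x <= u <= x + 1 -> 0 <= ln u <= ln (x + 1).
  by move=> hu; split; [apply: ln_ge0; lra | apply: ln_le; lra].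
have iu u : x <= u -> 0 < / u <= / x.
  by move=> hu; split; [apply: Rinv_0_lt_compat; lra | apply: Rinv_le_contravar].
have bsq u : x <= u <= x + 1 -> (1 + ln u) ^ 2 <= (1 + ln (x + 1)) ^ 2.
  by move=> /mon hu; apply: pow_incr; lra.
have bF u : x <= u <= x + 1 -> Rabs (F u) <= (1 + ln (x + 1)) ^ 2 * exp (- ln x).
  move=> hu; have [u1 u2] := iu u ltac:(lra); rewrite /F Rabs_mult (Rabs_pos_eq (/ u)); last lra.
  rewrite -ix; apply: Rmult_le_compat => //; [exact: Rabs_pos | lra |].
  by apply: Rle_trans (bg _ _) (bsq u hu); have := mon u hu; lra.
have bF' u : x <= u <= x + 1 -> Rabs (F' u) <= 4 * T * ((1 + ln (x + 1)) ^ 2 * exp (- ln x) * exp (- ln x)).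
  move=> hu; have [u1 u2] := iu u ltac:(lra); rewrite /F' !Rabs_mult (Rabs_pos_eq (/ u)); last lra.
  have -> : 4 * T * ((1 + ln (x + 1)) ^ 2 * exp (- ln x) * exp (- ln x)) =
    4 * T * (1 + ln (x + 1)) ^ 2 * exp (- ln x) * exp (- ln x) by ring.
  have a0 := Rabs_pos (g' (ln u) - g (ln u)).
  rewrite -ix; apply: Rmult_le_compat => //; [by apply: Rmult_le_pos; lra | lra |].
  apply: Rmult_le_compat => //; first lra.
  apply: Rle_trans (Rabs_triang _ _) _; rewrite Rabs_Ropp.
  apply: Rle_trans (bg' _ _) _; first by have := mon u hu; lra.
  by apply: Rmult_le_compat_l (bsq u hu); lra.
have [|u hu|xi [hxi e]] := @MVT_gen (fun u => P (ln u)) x (x + 1) (fun u => - F u).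
- by move=> u hu; apply: dQ; rewrite Rmin_left in hu; lra.
- apply/continuity_pt_filterlim/(@ex_derive_continuous _ R_NormedModule); exists (- F u); apply: dQ.
  by rewrite Rmin_left in hu; lra.
rewrite Rmin_left ?Rmax_right in hxi; try lra.
rewrite e -/(F x) (_ : F x + - F xi * (x + 1 - x) = F x - F xi); last by ring.
apply: (@gterm_bound c C (ln x) (ln (x + 1)) T) => //.
  apply: Rle_trans (Rabs_triang _ _) _; rewrite Rabs_Ropp.
  have := bF x ltac:(lra); have := bF xi hxi; lra.
rewrite Rabs_minus_sym.
have := @MVT_bound F F' x xi _ (proj1 hxi) (fun u hu => dF u ltac:(lra)) (fun u hu => bF' u ltac:(lra)).
set B := 4 * T * _ => h; apply: Rle_trans h _.
have B0 : 0 <= B by apply: Rle_trans (bF' x ltac:(lra)); exact: Rabs_pos.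
nra.
Qed.

(** Derivative of a complex function of a real variable, by components, so that the real statement
    [gsum_bound] applies to each part. *)
Definition CD (f : R -> C) (x : R) (l : C) : Prop :=
  is_derive (fun y => fst (f y)) x (fst l) /\ is_derive (fun y => snd (f y)) x (snd l).

Lemma CD_eq f x l l' : CD f x l -> l = l' -> CD f x l'.
Proof. by move=> h <-. Qed.

Lemma CD_mult f g x l m : CD f x l -> CD g x m ->
  CD (fun y => f y * g y)%C x (l * g x + f x * m)%C.
Proof.
move=> [f1 f2] [g1 g2]; split.
  have d := is_derive_minus _ _ _ _ _ (is_derive_mult _ _ _ _ _ f1 g1 Rmult_comm)
    (is_derive_mult _ _ _ _ _ f2 g2 Rmult_comm).
  apply: (is_derive_eq d); rewrite /minus /opp /plus /mult /=; ring.
have d := is_derive_plus _ _ _ _ _ (is_derive_mult _ _ _ _ _ f1 g2 Rmult_comm)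
  (is_derive_mult _ _ _ _ _ f2 g1 Rmult_comm).
apply: (is_derive_eq d); rewrite /plus /mult /=; ring.
Qed.

Lemma CD_plus f g x l m : CD f x l -> CD g x m -> CD (fun y => f y + g y)%C x (l + m)%C.
Proof. by move=> [f1 f2] [g1 g2]; split; apply: (@is_derive_plus _ R_NormedModule). Qed.

Lemma CD_const (z : C) x : CD (fun=> z) x 0%C.
Proof. by split; apply: (@is_derive_const _ R_NormedModule). Qed.

Lemma CD_real (f : R -> R) x l : is_derive f x l -> CD (fun y => RtoC (f y)) x (RtoC l).
Proof. by move=> h; split => //; apply: (@is_derive_const _ R_NormedModule). Qed.

(** The function e^(-z v). *)
Definition cexpm (z : C) (v : R) : C :=
  (exp (- fst z * v) * cos (snd z * v), - (exp (- fst z * v) * sin (snd z * v))).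

Lemma CD_cexpm z v : CD (cexpm z) v (- z * cexpm z v)%C.
Proof.
by split; rewrite /cexpm /=; auto_derive => //; ring.
Qed.

Lemma Cmod_cexpm z v : Cmod (cexpm z v) = exp (- fst z * v).
Proof.
rewrite /Cmod /cexpm /= (_ : _ + _ = Rsqr (exp (- fst z * v))); last first.
  have := sin2_cos2 (snd z * v); rewrite /Rsqr => e.
  rewrite -[RHS]Rmult_1_r -[in RHS]e; ring.
by rewrite sqrt_Rsqr //; exact/Rlt_le/exp_pos.
Qed.

Definition Tp (t : R) : R := 1 + Rabs t.

Lemma Tp_ge1 t : 1 <= Tp t.
Proof. by rewrite /Tp; have := Rabs_pos t; lra. Qed.

(* The polynomial [p v = al v^2 + be v + ga] is chosen so that [e^(-z v) p v] is an
   antiderivative of [- e^(-z v) q v]. *)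
Lemma Dir_pole_bound c : 0 < c <= 1 -> exists2 K, 0 < K &
  forall (q q' : R -> R) (al be ga : C) (s t : R), 1 < s <= 2 ->
  (forall v, is_derive q v (q' v)) ->
  (forall v, 0 <= v -> Rabs (q v) <= (1 + v) ^ 2 /\ Rabs (q' v) <= 2 * (1 + v) ^ 2) ->
  (forall v : R, (s - 1, t)%R * (al * RtoC (v ^ 2) + be * RtoC v + ga) - (2 * al * RtoC v + be) = RtoC (q v))%C ->
  Cmod (Dir (fun n => q (ln (INR n))) s t - ga)%C <= K * exp (c * ln (Tp t)).
Proof.
move=> hc; have [K K0 hK] := gsum_bound hc; exists (2 * K); first lra.
move=> q q' al be ga s t [s1 s2] dq bq hp.
set z : C := (s - 1, t); pose T := Tp t; have T1 := Tp_ge1 t.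
(* Here z is s - 1 + it, not s + it: the missing factor 1/n is the 1/u of the Euler summation, so g
   (ln n) / n is the n-th term of the series. The value P 0 = [ga] is the polar part. *)
pose g v := (cexpm z v * RtoC (q v))%C.
pose g' v := (- z * cexpm z v * RtoC (q v) + cexpm z v * RtoC (q' v))%C.
pose P v := (cexpm z v * (al * RtoC (v ^ 2) + be * RtoC v + ga))%C.
have dg v : CD g v (g' v) by apply: CD_mult; [exact: CD_cexpm | exact: CD_real].
have dP v : CD P v (- g v)%C.
  have d2 : is_derive (fun v : R => v ^ 2) v (2 * v) by auto_derive => //; ring.
  have d1 : is_derive (fun v : R => v) v 1 by auto_derive.
  have d := CD_mult (CD_cexpm z v) (CD_plus (CD_plus (CD_mult (CD_const al v) (CD_real d2))
    (CD_mult (CD_const be v) (CD_real d1))) (CD_const ga v)).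
  apply: (CD_eq d); rewrite /g -(hp v) -/z RtoC_mult; ring.
have z0 : Cmod z <= T.
  apply: Rle_trans (Cmod_le_sum _) _; rewrite /T /Tp /= Rabs_pos_eq; lra.
have Cm v : 0 <= v -> Cmod (cexpm z v) <= 1.
  move=> v0; rewrite Cmod_cexpm -exp_0 /z /=.
  by apply: exp_mono; nra.
have bg v : 0 <= v -> Cmod (g v) <= (1 + v) ^ 2.
  move=> v0; rewrite /g Cmod_mult Cmod_R; have [b _] := bq v v0.
  have := Cm v v0; have := Cmod_ge_0 (cexpm z v); have := Rabs_pos (q v); nra.
have bg' v : 0 <= v -> Cmod (g' v) + Cmod (g v) <= 4 * T * (1 + v) ^ 2.
  move=> v0; have b := bg v v0; have [_ b2] := bq v v0.
  have : Cmod (g' v) <= T * (1 + v) ^ 2 + 2 * (1 + v) ^ 2.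
    apply: Rle_trans (Cmod_triangle _ _) _; apply: Rplus_le_compat.
      have -> : (- z * cexpm z v * RtoC (q v) = - z * g v)%C by rewrite /g; ring.
      rewrite Cmod_mult Cmod_opp; apply: Rmult_le_compat => //; exact: Cmod_ge_0.
    rewrite Cmod_mult Cmod_R; have := Cm v v0; have := Cmod_ge_0 (cexpm z v); have := Rabs_pos (q' v); nra.
  have := pow2_ge_0 (1 + v); rewrite -/T in T1; nra.
have lP : is_lim_seq (fun N => Cmod (P (ln (INR N.+1)))) 0.
  pose a := s - 1; have a2 : 0 < a / 2 by rewrite /a; lra.
  have [C C0 hC] := poly_exp a2.
  pose M := Cmod al + Cmod be + Cmod ga.
  have ma := Cmod_ge_0 al; have mb := Cmod_ge_0 be; have mg := Cmod_ge_0 ga.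
  have l0 : is_lim_seq (fun N => M * C * exp (- (a / 2) * ln (INR N.+1))) 0.
    have -> : Rbar.Finite 0 = Rbar_mult (Rbar.Finite (M * C)) (Rbar.Finite 0) by rewrite /= Rmult_0_r.
    by apply: is_lim_seq_scal_l; apply/(is_lim_seq_incr_1 (fun N => exp (- (a / 2) * ln (INR N)))); exact: exp_ln_lim0.
  apply: (is_lim_seq_le_le (fun=> 0) _ _ _ _ (is_lim_seq_const 0) l0) => N.
  split; first exact: Cmod_ge_0.
  set v := ln _; have v0 : 0 <= v := ln_INR_ge0 _.
  rewrite /P Cmod_mult Cmod_cexpm [fst z]/= -/a.
  have : Cmod (al * RtoC (v ^ 2) + be * RtoC v + ga)%C <= M * (1 + v) ^ 2.
    apply: Rle_trans (Cmod_triangle _ _) _.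
    apply: Rle_trans (Rplus_le_compat_r _ _ _ (Cmod_triangle _ _)) _.
    rewrite !Cmod_mult !Cmod_R !Rabs_pos_eq //; last exact: pow2_ge_0.
    rewrite /M; nra.
  have h := hC v v0; have M0 : 0 <= M by rewrite /M; lra.
  move=> h2; have {}h2 := Rle_trans _ _ _ h2 (Rmult_le_compat_l _ _ _ M0 h).
  have -> : M * C * exp (- (a / 2) * v) = exp (- a * v) * (M * (C * exp (a / 2 * v))).
    have -> : exp (- (a / 2) * v) = exp (- a * v) * exp (a / 2 * v) by rewrite -exp_plus; congr exp; field.
    ring.
  by apply: Rmult_le_compat_l h2; exact/Rlt_le/exp_pos.
have aq : adm (fun n => q (ln (INR n))).
  by exists 1; [lra | move=> n; rewrite Rmult_1_l; have [] := bq _ (ln_INR_ge0 n)].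
have P0 : P 0 = ga by rewrite /P /cexpm /= !Rmult_0_r exp_0 cos_0 sin_0 /Cmult /Cplus /=; case: ga {hp P dP lP} => x y /=; congr (_, _); ring.
have lim_abs (f : nat -> R) : (forall N, Rabs (f N) <= Cmod (P (ln (INR N.+1)))) -> is_lim_seq f 0.
  move=> h; apply/is_lim_seq_abs_0; apply: (is_lim_seq_le_le (fun=> 0) _ _ _ _ (is_lim_seq_const 0) lP) => N.
  by split; [exact: Rabs_pos | exact: h].
have dcos0 : dcos s t 0 = 0 by rewrite /dcos Rmult_0_l.
have dsin0 : dsin s t 0 = 0 by rewrite /dsin Rmult_0_l.
have fstg v : fst (g v) = exp (- (s - 1) * v) * cos (t * v) * q v by rewrite /g /cexpm /=; ring.
have sndg v : snd (g v) = - (exp (- (s - 1) * v) * sin (t * v)) * q v by rewrite /g /cexpm /=; ring.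
have br : Rabs (fst (Dir (fun n => q (ln (INR n))) s t) - fst (P 0)) <= K * exp (c * ln T).
  apply: (hK (fun v => fst (g v)) (fun v => fst (g' v)) (fun v => fst (P v))) => //.
  - by move=> v _; have [] := dg v.
  - by move=> v _; have [] := dP v.
  - by move=> v v0; apply: Rle_trans (Cmod_re _) (bg v v0).
  - by move=> v v0; apply: Rle_trans (bg' v v0); apply: Rplus_le_compat; exact: Cmod_re.
  - by apply: lim_abs => N; exact: Cmod_re.
  have /is_lim_seq_incr_1 := is_lim_seq_sum (ex_dcos t aq s1).
  apply: is_lim_seq_ext => N; rewrite sumR_recl dcos0 Rmult_0_r Rplus_0_l.
  apply: eq_bigr => n _; rewrite fstg /dcos nps_gt0 //.
  have -> : / INR n.+1 = exp (- ln (INR n.+1)) by rewrite exp_Ropp exp_ln //; exact: INR_gt0.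
  set v := ln _; have -> : exp (- s * v) = exp (- (s - 1) * v) * exp (- v) by rewrite -exp_plus; congr exp; ring.
  ring.
have bi : Rabs (snd (Dir (fun n => q (ln (INR n))) s t) - snd (P 0)) <= K * exp (c * ln T).
  apply: (hK (fun v => snd (g v)) (fun v => snd (g' v)) (fun v => snd (P v))) => //.
  - by move=> v _; have [] := dg v.
  - by move=> v _; have [] := dP v.
  - by move=> v v0; apply: Rle_trans (Cmod_im _) (bg v v0).
  - by move=> v v0; apply: Rle_trans (bg' v v0); apply: Rplus_le_compat; exact: Cmod_im.
  - by apply: lim_abs => N; exact: Cmod_im.
  have /is_lim_seq_incr_1 /is_lim_seq_opp := is_lim_seq_sum (ex_dsin t aq s1).
  apply: is_lim_seq_ext => N; rewrite sumR_recl dsin0 Rmult_0_r Rplus_0_l -sumR_opp.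
  apply: eq_bigr => n _; rewrite sndg /dsin nps_gt0 //.
  have -> : / INR n.+1 = exp (- ln (INR n.+1)) by rewrite exp_Ropp exp_ln //; exact: INR_gt0.
  set v := ln _; have -> : exp (- s * v) = exp (- (s - 1) * v) * exp (- v) by rewrite -exp_plus; congr exp; ring.
  ring.
rewrite P0 in br bi; apply: Rle_trans (Cmod_le_sum _) _.
rewrite -[fst (_ - _)%C]/(fst (Dir (fun n => q (ln (INR n))) s t) - fst ga).
rewrite -[snd (_ - _)%C]/(snd (Dir (fun n => q (ln (INR n))) s t) - snd ga).
rewrite -/T; lra.
Qed.

(** * Logarithmic derivative of zeta up to the line [Re s = 1] *)

Lemma Cmod_add_le (a b : C) A B : Cmod a <= A -> Cmod b <= B -> Cmod (a + b)%C <= A + B.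
Proof. by move=> h g; apply: Rle_trans (Cmod_triangle _ _) _; lra. Qed.

Lemma Cmod_sub_le (a b : C) A B : Cmod a <= A -> Cmod b <= B -> Cmod (a - b)%C <= A + B.
Proof. by move=> h g; apply: Cmod_add_le => //; rewrite Cmod_opp. Qed.

Lemma Cmod_mul_le (a b : C) A B : Cmod a <= A -> Cmod b <= B -> Cmod (a * b)%C <= A * B.
Proof. by move=> h g; rewrite Cmod_mult; apply: Rmult_le_compat => //; exact: Cmod_ge_0. Qed.

Lemma Cmod_inv_le (a : C) A : 0 < A -> / A <= Cmod a -> Cmod (/ a)%C <= A.
Proof.
move=> A0 h; have iA := Rinv_0_lt_compat _ A0.
rewrite Cmod_inv; last by apply/Cmod_gt_0; lra.
by rewrite -(Rinv_inv A); apply: Rinv_le_contravar.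
Qed.

Lemma Cmod_neq0 (a : C) : 0 < Cmod a -> a <> 0%C.
Proof. exact: (proj2 (Cmod_gt_0 a)). Qed.

(** For q = 1, v, v^2 the equation z p - p' = q has the solutions 1/z, v/z + 1/z^2 and v^2/z +
    2v/z^2 + 2/z^3; their constant terms are the poles. *)
Lemma zeta_pole_bounds c : 0 < c <= 1 -> exists2 K, 1 <= K & forall s t, 1 < s <= 2 ->
  let z : C := (s - 1, t) in let B := K * exp (c * ln (Tp t)) in
  [/\ Cmod (zeta s t - / z)%C <= B, Cmod (zeta1 s t - / (z * z))%C <= B &
      Cmod (zeta2 s t - 2 / (z * z * z))%C <= B].
Proof.
move=> hc; have [K K0 hK] := Dir_pole_bound hc; exists (K + 1); first lra.
move=> s t hs z B.
have z0 : z <> 0%C by case=> h _; lra.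
have KB : K * exp (c * ln (Tp t)) <= B.
  by rewrite /B; have := exp_pos (c * ln (Tp t)); nra.
split; apply: Rle_trans KB.
- apply: (hK (fun=> 1) (fun=> 0) 0%C 0%C (/ z)%C) => //.
  + by move=> v; apply: (@is_derive_const _ R_NormedModule).
  + by move=> v v0; rewrite Rabs_R1 Rabs_R0; nra.
  + by move=> v; cbv beta; rewrite -/z; field.
- apply: (hK (fun v => v) (fun=> 1) 0%C (/ z)%C (/ (z * z))%C) => //.
  + by move=> v; auto_derive.
  + by move=> v v0; rewrite Rabs_R1 Rabs_pos_eq //; nra.
  + by move=> v; cbv beta; rewrite -/z; field.
- apply: (hK (fun v => v ^ 2) (fun v => 2 * v) (/ z)%C (2 / (z * z))%C (2 / (z * z * z))%C) => //.
  + by move=> v; auto_derive => //; ring.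
  + by move=> v v0; rewrite !Rabs_pos_eq; nra.
  + by move=> v; cbv beta; rewrite -/z; field.
Qed.

(** With Q = z zeta = 1 + z G0, the size condition forces |z G0| <= 1/2, so Q is invertible.
    Subtracting [zeta] and [zeta1] themselves, which matches the coefficients Lambda - 1 and (Lambda
    - 1) ln, cancels every negative power of z algebraically. *)
Lemma log_derivative_bounds_near1 g r s t : 1 <= g -> 0 < r -> 4 * r * g <= 1 ->
  1 < s <= 1 + r -> Rabs t <= r ->
  let z : C := (s - 1, t) in
  Cmod (zeta s t - / z)%C <= g -> Cmod (zeta1 s t - / (z * z))%C <= g ->
  Cmod (zeta2 s t - 2 / (z * z * z))%C <= g ->
  Cmod (LA s t - zeta s t)%C <= 40 * g ^ 3 /\ Cmod (LB s t - zeta1 s t)%C <= 40 * g ^ 3.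
Proof.
move=> g1 r0 rg hs ht z.
set G0 := (zeta s t - / z)%C; set G1 := (zeta1 s t - _)%C; set G2 := (zeta2 s t - _)%C.
move=> h0 h1 h2.
have z0 : z <> 0%C by case=> h _; lra.
have zr : Cmod z <= 2 * r.
  by apply: Rle_trans (Cmod_le_sum _) _; rewrite /= Rabs_pos_eq; lra.
have z1 : Cmod z <= 1 by nra.
pose Q := (1 + z * G0)%C.
have hQ : / 2 <= Cmod Q.
  have : Cmod 1%C <= Cmod Q + Cmod (z * G0)%C.
    have -> : RtoC 1 = (Q - z * G0)%C by rewrite /Q; ring.
    by apply: Cmod_sub_le; lra.
  have : Cmod (z * G0)%C <= 2 * r * g by exact: Cmod_mul_le.
  rewrite Cmod_1; lra.
have Q0 : Q <> 0%C by apply: Cmod_neq0; lra.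
have iQ : Cmod (/ Q)%C <= 2 by apply: Cmod_inv_le; lra.
have e0 : zeta s t = (Q / z)%C by rewrite /Q /G0; field.
have zt0 : zeta s t <> 0%C by rewrite e0 => e; apply: Q0; rewrite (_ : Q = (Q / z * z)%C); [rewrite e; ring | field].
have s1 : 1 < s by lra.
have e1 : zeta1 s t = (G1 + / (z * z))%C by rewrite /G1; ring.
have e2 : zeta2 s t = (G2 + 2 / (z * z * z))%C by rewrite /G2; ring.
have eA : LA s t = (zeta1 s t / zeta s t)%C by rewrite -(LA_zeta t s1); field.
have eB : LB s t = ((zeta2 s t - LA s t * zeta1 s t) / zeta s t)%C by rewrite -(LB_zeta t s1); field.
have g2 : 1 <= g ^ 2 by apply: pow_R1_Rle.
have two : Cmod 2%C <= 2 by rewrite Cmod_R Rabs_pos_eq; lra.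
have three : Cmod 3%C <= 3 by rewrite Cmod_R Rabs_pos_eq; lra.
have Q1 : Q <> 0%C -> (1 + z * G0)%C <> 0%C by [].
split.
  have -> : (LA s t - zeta s t = (z * G1 - 2 * G0 - z * (G0 * G0)) * / Q)%C.
    by rewrite eA e1 e0 /Q; field; split => //; exact: Q1.
  have : Cmod ((z * G1 - 2 * G0 - z * (G0 * G0)) * / Q)%C <= (1 * g + 2 * g + 1 * (g * g)) * 2.
    by repeat (apply: Cmod_mul_le => // || apply: Cmod_sub_le => //).
  move=> h; apply: Rle_trans h _; nra.
have -> : (LB s t - zeta1 s t = (z * G2 + z * (z * (G2 * G0)) - 3 * G1 - z * (z * (G1 * G1)) - G0 * G0
   - 2 * (z * (G1 * G0)) - z * (z * (G1 * (G0 * G0)))) * (/ Q * / Q))%C.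
  by rewrite eB eA e2 e1 e0 /Q; field; split => //; exact: Q1.
set W := (_ * (/ Q * / Q))%C.
have : Cmod W <= (1 * g + 1 * (1 * (g * g)) + 3 * g + 1 * (1 * (g * g)) + g * g + 2 * (1 * (g * g))
   + 1 * (1 * (g * (g * g)))) * (2 * 2).
  by rewrite /W; repeat (apply: Cmod_mul_le => // || apply: Cmod_sub_le => // || apply: Cmod_add_le => //).
move=> h; apply: Rle_trans h _.
(* The bound is 4 (4 g + 5 g^2 + g^3), hence the constant 40. *)
have : g <= g ^ 3 by nra.
have : g ^ 2 <= g ^ 3 by nra.
lra.
Qed.

Lemma log_derivative_bounds_far M s t : 1 <= M -> 1 < s <= 2 ->
  Cmod (zeta s t) <= M -> Cmod (zeta1 s t) <= M -> Cmod (zeta2 s t) <= M ->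
  / (2 ^ 18 * M ^ 4) <= Cmod (zeta s t) ->
  Cmod (LA s t - zeta s t)%C <= 2 ^ 38 * M ^ 10 /\ Cmod (LB s t - zeta1 s t)%C <= 2 ^ 38 * M ^ 10.
Proof.
move=> M1 hs h0 h1 h2 hl; have s1 : 1 < s by lra.
have Mk k : 1 <= M ^ k by apply: pow_R1_Rle.
have M4 := Mk 4%N.
have zt0 : zeta s t <> 0%C by apply: Cmod_neq0; apply: Rlt_le_trans hl; apply: Rinv_0_lt_compat; lra.
have iz : Cmod (/ zeta s t)%C <= 2 ^ 18 * M ^ 4 by apply: Cmod_inv_le => //; lra.
have eA : LA s t = (zeta1 s t * / zeta s t)%C by rewrite -(LA_zeta t s1); field.
have eB : LB s t = ((zeta2 s t - LA s t * zeta1 s t) * / zeta s t)%C by rewrite -(LB_zeta t s1); field.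
have bA : Cmod (LA s t) <= 2 ^ 18 * M ^ 5.
  by rewrite eA; apply: Rle_trans (Cmod_mul_le h1 iz) _; apply/Req_le; ring.
have p n m : (n <= m)%N -> M ^ n <= M ^ m by move=> h; apply: Rle_pow => //; apply/leP.
have := p 5%N 10%N isT; have := p 6%N 10%N isT; have := p 1%N 10%N isT; rewrite pow_1 => p1 p6 p5.
split.
  by apply: Rle_trans (Cmod_sub_le bA h0) _; lra.
have bB : Cmod (LB s t) <= 2 ^ 37 * M ^ 10.
  rewrite eB; apply: Rle_trans (Cmod_mul_le (Cmod_sub_le h2 (Cmod_mul_le bA h1)) iz) _.
  have -> : (M + 2 ^ 18 * M ^ 5 * M) * (2 ^ 18 * M ^ 4) = 2 ^ 18 * M ^ 5 + 2 ^ 36 * M ^ 10 by ring.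
  lra.
by apply: Rle_trans (Cmod_sub_le bB h1) _; lra.
Qed.

Lemma exp_mul_INR n x : exp (INR n * x) = exp x ^ n.
Proof.
elim: n => [|n IH]; first by rewrite /= Rmult_0_l exp_0.
by rewrite S_INR Rmult_plus_distr_r exp_plus IH Rmult_1_l /=; ring.
Qed.

Lemma log_derivative_bounds c : 0 < c <= 1 -> exists K r, 0 < K /\ 0 < r <= 1 /\
  forall s t, 1 < s <= 1 + r ->
  Cmod (LA s t - zeta s t)%C <= K * exp (c * ln (Tp t)) /\
  Cmod (LB s t - zeta1 s t)%C <= K * exp (c * ln (Tp t)).
Proof.
(* The bound away from the pole is a tenth power of the size of zeta, so zeta is controlled with
   exponent c / 10. *)
move=> [c0 c1]; pose d := c / 10; have hd : 0 < d <= 1 by rewrite /d; lra.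
have [K0 K01 hG] := zeta_pole_bounds hd.
(* This makes 4 r g = 1 for g = 2 K0, the size of the regular parts when |t| <= r. *)
pose r := / (8 * K0); have r0 : 0 < r by apply: Rinv_0_lt_compat; lra.
have rK : 8 * r * K0 = 1 by rewrite /r; field; lra.
have r1 : r <= 1 by nra.
have ir : 1 <= / r by rewrite -Rinv_1; apply: Rinv_le_contravar.
(* For |t| > r the poles are at most 2 / r^3. The 2 in front of [K0] leaves room for the point 2 t,
   where (1 + |2t|)^d <= 2 (1 + |t|)^d. *)
pose K2 := 2 / r ^ 3 + 2 * K0.
have ir3 : / r ^ 3 = / r * / r * / r by field; lra.
have ir2 : / r <= / r * / r by nra.
have ir23 : / r * / r <= / r * / r * / r by nra.
have K21 : 1 <= K2 by rewrite /K2 /Rdiv ir3; nra.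
have tau1 t : 1 <= exp (d * ln (Tp t)).
  by have := exp_ge_lin (d * ln (Tp t)); have := ln_ge0 (Tp_ge1 t); nra.
exists (40 * (2 * K0) ^ 3 + 2 ^ 38 * K2 ^ 10), r.
have P1 : 0 < (2 * K0) ^ 3 by apply: pow_lt; lra.
have P2 : 0 < K2 ^ 10 by apply: pow_lt; lra.
split; [lra | split; first lra] => s t hs; have hs2 : 1 < s <= 2 by lra.
have l0 := ln_ge0 (Tp_ge1 t).
have tauc : exp (c * ln (Tp t)) = exp (d * ln (Tp t)) ^ 10.
  by rewrite -exp_mul_INR; congr exp; rewrite /d /=; field.
have c1' : 1 <= exp (c * ln (Tp t)) by rewrite tauc; apply: pow_R1_Rle.
case: (Rle_lt_dec (Rabs t) r) => ht.
  have tau2 : exp (d * ln (Tp t)) <= 2.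
    have : d * ln (Tp t) <= ln 2.
      have : ln (Tp t) <= ln 2 by apply: ln_le; [have := Tp_ge1 t; lra | rewrite /Tp; lra].
      nra.
    rewrite -{2}(exp_ln 2); last lra.
    exact: exp_mono.
  have [h0 h1 h2] := hG s t hs2.
  have bd : K0 * exp (d * ln (Tp t)) <= 2 * K0 by nra.
  have [] := @log_derivative_bounds_near1 (2 * K0) r s t ltac:(lra) r0 ltac:(lra) hs ht
    (Rle_trans _ _ _ h0 bd) (Rle_trans _ _ _ h1 bd) (Rle_trans _ _ _ h2 bd).
  have : 40 * (2 * K0) ^ 3 <= (40 * (2 * K0) ^ 3 + 2 ^ 38 * K2 ^ 10) * exp (c * ln (Tp t)) by nra.
  lra.
pose M := K2 * exp (d * ln (Tp t)); have tau := tau1 t.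
have M1 : 1 <= M by rewrite /M; nra.
have two : Cmod 2%C <= 2 by rewrite Cmod_R Rabs_pos_eq; lra.
have hz u x : r < Rabs u -> 1 < x <= 2 -> exp (d * ln (Tp u)) <= 2 * exp (d * ln (Tp t)) ->
  [/\ Cmod (zeta x u) <= M, Cmod (zeta1 x u) <= M & exp (d * ln (Tp u)) <= exp (d * ln (Tp t)) -> Cmod (zeta2 x u) <= M].
  move=> hu hx hT; have [h0 h1 h2] := hG x u hx; set z : C := (x - 1, u) in h0 h1 h2.
  have zr : / / r <= Cmod z by rewrite Rinv_inv; have := Cmod_im z; rewrite /=; lra.
  have iz := Cmod_inv_le (Rinv_0_lt_compat _ r0) zr.
  have z0 : z <> 0%C by case=> h _; lra.
  have izz : Cmod (/ (z * z))%C <= / r * / r.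
    by have -> : (/ (z * z) = / z * / z)%C by [field]; apply: Cmod_mul_le.
  have izzz : Cmod (2 / (z * z * z))%C <= 2 * (/ r * / r * / r).
    have -> : (2 / (z * z * z) = 2 * (/ z * / z * / z))%C by field.
    by repeat apply: Cmod_mul_le.
  have ez (a b : C) : a = (a - b + b)%C by ring.
  have KT : K0 * exp (d * ln (Tp u)) <= 2 * K0 * exp (d * ln (Tp t)) by nra.
  have big y : y <= 2 * (/ r * / r * / r) -> y + 2 * K0 * exp (d * ln (Tp t)) <= M.
    move=> hy; rewrite /M /K2 /Rdiv ir3; nra.
  split.
  - rewrite (ez (zeta x u) (/ z)%C); apply: Rle_trans (Cmod_add_le h0 iz) _.
    have := big (/ r) ltac:(nra); lra.
  - rewrite (ez (zeta1 x u) (/ (z * z))%C); apply: Rle_trans (Cmod_add_le h1 izz) _.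
    have := big (/ r * / r) ltac:(nra); lra.
  - move=> _; rewrite (ez (zeta2 x u) (2 / (z * z * z))%C); apply: Rle_trans (Cmod_add_le h2 izzz) _.
    have := big (2 * (/ r * / r * / r)) ltac:(nra); lra.
have T2 : exp (d * ln (Tp (2 * t))) <= 2 * exp (d * ln (Tp t)).
  have : ln (Tp (2 * t)) <= ln 2 + ln (Tp t).
    have := Tp_ge1 t; have := Tp_ge1 (2 * t) => q1 q2.
    rewrite -ln_mult; [|lra|lra]; apply: ln_le; first lra.
    by rewrite /Tp Rabs_mult (Rabs_pos_eq 2); have := Rabs_pos t; lra.
  have l2 : 0 < ln 2 by rewrite -ln_1; apply: ln_increasing; lra.
  move=> h; have : d * ln (Tp (2 * t)) <= ln 2 + d * ln (Tp t) by nra.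
  have -> : 2 * exp (d * ln (Tp t)) = exp (ln 2 + d * ln (Tp t)) by rewrite exp_plus exp_ln; lra.
  exact: exp_mono.
have ht2 : r < Rabs (2 * t) by rewrite Rabs_mult (Rabs_pos_eq 2); have := Rabs_pos t; lra.
have hl := @zeta_lower M t M1 _ s hs2.
have [b0 b1 b2] := hz t s ht hs2 ltac:(lra).
have [] := @log_derivative_bounds_far M s t M1 hs2 b0 b1 (b2 ltac:(lra)) _.
  apply: hl => x hx; have [q0 q1 _] := hz t x ht hx ltac:(lra); have [q2 _ _] := hz _ x ht2 hx T2.
  by split; [|split].
have : 2 ^ 38 * M ^ 10 <= (40 * (2 * K0) ^ 3 + 2 ^ 38 * K2 ^ 10) * exp (c * ln (Tp t)).
  rewrite /M Rpow_mult_distr -tauc; nra.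
lra.
Qed.

(** * A band-limited minorant *)

(* The property of [f] needed from being the Fourier transform of a measure of mass [M] on
   [-Om, Om], stated through finite sums so that it is visibly closed under products. *)
Definition bandlimited (f : R -> R) (Om M : R) : Prop :=
  forall (N : nat) (c u : nat -> R) (S : R),
  (forall w, Rabs w <= Om -> Rabs (\sum_(0 <= n < N) (c n * cos (w * u n))) <= S /\
                             Rabs (\sum_(0 <= n < N) (c n * sin (w * u n))) <= S) ->
  Rabs (\sum_(0 <= n < N) (c n * f (u n))) <= M * S.

Lemma sumR_lin2 (N : nat) (c f g : nat -> R) a b S :
  Rabs (\sum_(0 <= n < N) (c n * f n)) <= S -> Rabs (\sum_(0 <= n < N) (c n * g n)) <= S ->
  Rabs (\sum_(0 <= n < N) (c n * (a * f n + b * g n))) <= (Rabs a + Rabs b) * S.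
Proof.
move=> hf hg.
have -> : \sum_(0 <= n < N) (c n * (a * f n + b * g n)) =
  a * (\sum_(0 <= n < N) (c n * f n)) + b * (\sum_(0 <= n < N) (c n * g n)).
  by rewrite !big_distrr /= -big_split; apply: eq_bigr => n _ /=; ring.
apply: Rle_trans (Rabs_triang _ _) _; rewrite !Rabs_mult.
have := Rmult_le_compat_l _ _ _ (Rabs_pos a) hf; have := Rmult_le_compat_l _ _ _ (Rabs_pos b) hg; lra.
Qed.

Lemma bandlimited_ext f g Om M : (forall w, f w = g w) -> bandlimited f Om M -> bandlimited g Om M.
Proof.
move=> e h N c u S hS; rewrite -(@eq_bigr _ _ _ _ _ _ (fun n => c n * f (u n))); first exact: h.
by move=> n _; rewrite e.
Qed.

(** Apply the property of [g] with the values of [f] absorbed into the coefficients, then that of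
    [f] with a cosine or sine absorbed; product-to-sum formulas leave frequencies w' + w and w' - w,
    inside O1 + O2. *)
Lemma bandlimited_mul f g O1 O2 M1 M2 : 0 <= M1 -> 0 <= M2 -> 0 <= O1 -> 0 <= O2 ->
  bandlimited f O1 M1 -> bandlimited g O2 M2 -> bandlimited (fun w => f w * g w) (O1 + O2) (M1 * M2).
Proof.
move=> m1 m2 o1 o2 hf hg N c u S hS.
rewrite (Rmult_comm M1) Rmult_assoc.
rewrite (eq_bigr (fun n => c n * f (u n) * g (u n))); last by move=> n _; ring.
apply: (hg N (fun n => c n * f (u n))) => w hw.
have half : Rabs (/ 2) + Rabs (/ 2) = 1 by rewrite Rabs_pos_eq; lra.
have half' : Rabs (/ 2) + Rabs (- / 2) = 1 by rewrite Rabs_Ropp Rabs_pos_eq; lra.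
have ww w' : Rabs w' <= O1 -> Rabs (w' + w) <= O1 + O2 /\ Rabs (w' - w) <= O1 + O2.
  move=> hw'; split; apply: Rle_trans (Rabs_triang _ _) _; rewrite ?Rabs_Ropp; lra.
split.
- rewrite (eq_bigr (fun n => c n * cos (w * u n) * f (u n))); last by move=> n _; ring.
  apply: (hf N (fun n => c n * cos (w * u n))) => w' /ww [/hS[p1 p2] /hS[q1 q2]]; split.
  + rewrite (eq_bigr (fun n => c n * (/ 2 * cos ((w' + w) * u n) + / 2 * cos ((w' - w) * u n)))).
      by have := @sumR_lin2 N c (fun n => cos ((w' + w) * u n)) (fun n => cos ((w' - w) * u n)) (/ 2) (/ 2) S p1 q1; rewrite half Rmult_1_l.
    by move=> n _; rewrite Rmult_plus_distr_r Rmult_minus_distr_r cos_plus cos_minus; field.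
  + rewrite (eq_bigr (fun n => c n * (/ 2 * sin ((w' + w) * u n) + / 2 * sin ((w' - w) * u n)))).
      by have := @sumR_lin2 N c (fun n => sin ((w' + w) * u n)) (fun n => sin ((w' - w) * u n)) (/ 2) (/ 2) S p2 q2; rewrite half Rmult_1_l.
    by move=> n _; rewrite Rmult_plus_distr_r Rmult_minus_distr_r sin_plus sin_minus; field.
- rewrite (eq_bigr (fun n => c n * sin (w * u n) * f (u n))); last by move=> n _; ring.
  apply: (hf N (fun n => c n * sin (w * u n))) => w' /ww [/hS[p1 p2] /hS[q1 q2]]; split.
  + rewrite (eq_bigr (fun n => c n * (/ 2 * sin ((w' + w) * u n) + - / 2 * sin ((w' - w) * u n)))).
      by have := @sumR_lin2 N c (fun n => sin ((w' + w) * u n)) (fun n => sin ((w' - w) * u n)) (/ 2) (- / 2) S p2 q2; rewrite half' Rmult_1_l.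
    by move=> n _; rewrite Rmult_plus_distr_r Rmult_minus_distr_r sin_plus sin_minus; field.
  + rewrite (eq_bigr (fun n => c n * (/ 2 * cos ((w' - w) * u n) + - / 2 * cos ((w' + w) * u n)))).
      by have := @sumR_lin2 N c (fun n => cos ((w' - w) * u n)) (fun n => cos ((w' + w) * u n)) (/ 2) (- / 2) S q1 p1; rewrite half' Rmult_1_l.
    by move=> n _; rewrite Rmult_plus_distr_r Rmult_minus_distr_r cos_plus cos_minus; field.
Qed.

Lemma bandlimited_lin f g Om M1 M2 a b : bandlimited f Om M1 -> bandlimited g Om M2 ->
  bandlimited (fun w => a * f w + b * g w) Om (Rabs a * M1 + Rabs b * M2).
Proof.
move=> hf hg N c u S hS.
have -> : \sum_(0 <= n < N) (c n * (a * f (u n) + b * g (u n))) =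
  a * (\sum_(0 <= n < N) (c n * f (u n))) + b * (\sum_(0 <= n < N) (c n * g (u n))).
  by rewrite !big_distrr /= -big_split; apply: eq_bigr => n _ /=; ring.
apply: Rle_trans (Rabs_triang _ _) _; rewrite !Rabs_mult.
have := Rmult_le_compat_l _ _ _ (Rabs_pos a) (hf N c u S hS).
have := Rmult_le_compat_l _ _ _ (Rabs_pos b) (hg N c u S hS); lra.
Qed.

Lemma bandlimited_cos a Om : Rabs a <= Om -> bandlimited (fun w => cos (a * w)) Om 1.
Proof. by move=> ha N c u S /(_ a ha) []; rewrite Rmult_1_l. Qed.

Lemma bandlimited_sin a Om : Rabs a <= Om -> bandlimited (fun w => sin (a * w)) Om 1.
Proof. by move=> ha N c u S /(_ a ha) []; rewrite Rmult_1_l. Qed.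

Lemma bandlimited_scal f Om M k A : Rabs k <= A -> 0 <= M -> 0 <= Om ->
  bandlimited f Om M -> bandlimited (fun w => k * f w) Om (A * M).
Proof.
move=> hk M0 O0 hf N c u S hS.
rewrite (eq_bigr (fun n => k * (c n * f (u n)))); last by move=> n _; ring.
rewrite -big_distrr /= Rabs_mult Rmult_assoc.
by apply: Rmult_le_compat => //; [exact: Rabs_pos | exact: Rabs_pos | exact: hf].
Qed.

(** An average of band-limited functions is band-limited; this is how the two Fejer-type kernels,
    averages of cosines and of sines, enter. *)
Lemma bandlimited_RInt (kern : R -> R -> R) Om M :
  (forall tau, 0 <= tau <= 1 -> bandlimited (kern tau) Om M) ->
  (forall w tau, continuous (fun tau => kern tau w) tau) ->
  bandlimited (fun w => RInt (fun tau => kern tau w) 0 1) Om M.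
Proof.
move=> hk hc N c u S hS.
have ex w : ex_RInt (fun tau => kern tau w) 0 1.
  by apply: ex_RInt_continuous => tau _; exact: hc.
have sumI n : is_RInt (fun tau => \sum_(0 <= i < n) (c i * kern tau (u i))) 0 1
  (\sum_(0 <= i < n) (c i * RInt (fun tau => kern tau (u i)) 0 1)).
  elim: n => [|n IH].
    rewrite big_nil; apply: (is_RInt_ext (fun=> 0)); first by move=> tau _; rewrite big_nil.
    by have := @is_RInt_const R_NormedModule 0 1 0; rewrite /scal /= /mult /= Rmult_0_r.
  rewrite sumR_recr.
  apply: (is_RInt_ext (fun tau => plus (\sum_(0 <= i < n) (c i * kern tau (u i))) (scal (c n) (kern tau (u n))))).
    by move=> tau _; rewrite sumR_recr.
  apply: is_RInt_plus IH _; apply: is_RInt_scal; exact: RInt_correct.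
rewrite -(is_RInt_unique _ _ _ _ (sumI N)).
have := @abs_RInt_le_const (fun tau => \sum_(0 <= i < N) (c i * kern tau (u i))) 0 1 (M * S).
rewrite Rminus_0_r Rmult_1_l; apply; first lra.
  by exists (\sum_(0 <= i < N) (c i * RInt (fun tau => kern tau (u i)) 0 1)).
by move=> tau htau; apply: hk.
Qed.

(* [fejer w = (sin w / w)^2] and [fejer1 w = sin^2 w / w]. *)
Definition fejer (w : R) : R := RInt (fun tau => 2 * (1 - tau) * cos (2 * tau * w)) 0 1.
Definition fejer1 (w : R) : R := RInt (fun tau => sin (2 * tau * w)) 0 1.

Lemma continuous_fejer w tau : continuous (fun tau => 2 * (1 - tau) * cos (2 * tau * w)) tau.
Proof. by apply: (@ex_derive_continuous _ R_NormedModule); auto_derive. Qed.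

Lemma continuous_fejer1 w tau : continuous (fun tau => sin (2 * tau * w)) tau.
Proof. by apply: (@ex_derive_continuous _ R_NormedModule); auto_derive. Qed.

Lemma is_RInt_fejer w : is_RInt (fun tau => 2 * (1 - tau) * cos (2 * tau * w)) 0 1 (fejer w).
Proof. by apply: RInt_correct; apply: ex_RInt_continuous => tau _; exact: continuous_fejer. Qed.

Lemma is_RInt_fejer1 w : is_RInt (fun tau => sin (2 * tau * w)) 0 1 (fejer1 w).
Proof. by apply: RInt_correct; apply: ex_RInt_continuous => tau _; exact: continuous_fejer1. Qed.

(** Integration by parts: (1 - tau) sin (2 tau w) vanishes at both ends. *)
Lemma fejer_mul w : w * fejer w = fejer1 w.
Proof.
have d : is_RInt (fun tau => 2 * (1 - tau) * w * cos (2 * tau * w) - sin (2 * tau * w)) 0 1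
  (minus ((1 - 1) * sin (2 * 1 * w)) ((1 - 0) * sin (2 * 0 * w))).
  apply: (is_RInt_derive (fun tau => (1 - tau) * sin (2 * tau * w))) => tau _.
    by auto_derive => //; ring.
  by apply: (@ex_derive_continuous _ R_NormedModule); auto_derive.
have e0 : is_RInt (fun tau => scal w (2 * (1 - tau) * cos (2 * tau * w))) 0 1 (scal w (fejer w)).
  by apply: is_RInt_scal; exact: is_RInt_fejer.
have e := is_RInt_minus _ _ _ _ _ _ e0 (@is_RInt_fejer1 w).
have : minus (scal w (fejer w)) (fejer1 w) = minus ((1 - 1) * sin (2 * 1 * w)) ((1 - 0) * sin (2 * 0 * w)).
  rewrite -(is_RInt_unique _ _ _ _ e) -(is_RInt_unique _ _ _ _ d); apply: RInt_ext => tau _.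
  by rewrite /minus /plus /opp /scal /= /mult /=; ring.
rewrite /minus /plus /opp /scal /= /mult /= Rmult_0_r Rmult_0_l sin_0; lra.
Qed.

Lemma fejer1_mul w : w * fejer1 w = sin w ^ 2.
Proof.
have d : is_RInt (fun tau => w * sin (2 * tau * w)) 0 1
  (minus (- cos (2 * 1 * w) / 2) (- cos (2 * 0 * w) / 2)).
  apply: (is_RInt_derive (fun tau => - cos (2 * tau * w) / 2)) => tau _.
    by auto_derive => //; field.
  by apply: (@ex_derive_continuous _ R_NormedModule); auto_derive.
have e : is_RInt (fun tau => scal w (sin (2 * tau * w))) 0 1 (scal w (fejer1 w)).
  by apply: is_RInt_scal; exact: is_RInt_fejer1.
have : scal w (fejer1 w) = minus (- cos (2 * 1 * w) / 2) (- cos (2 * 0 * w) / 2).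
  by rewrite -(is_RInt_unique _ _ _ _ e) -(is_RInt_unique _ _ _ _ d).
rewrite /minus /plus /opp /scal /= /mult /= !Rmult_0_r Rmult_0_l cos_0 Rmult_1_r cos_2a_sin => ->; field.
Qed.

Lemma bandlimited_fejer : bandlimited fejer 2 2.
Proof.
apply: bandlimited_RInt => [tau ht|]; last exact: continuous_fejer.
rewrite -[X in bandlimited _ _ X]Rmult_1_r; apply: bandlimited_scal; try lra.
  by rewrite Rabs_pos_eq; lra.
by apply: bandlimited_cos; rewrite Rabs_pos_eq; lra.
Qed.

Lemma bandlimited_fejer1 : bandlimited fejer1 2 1.
Proof.
apply: bandlimited_RInt => [tau ht|]; last exact: continuous_fejer1.
by apply: bandlimited_sin; rewrite Rabs_pos_eq; lra.
Qed.

Lemma bandlimited_sin2 : bandlimited (fun w => sin w ^ 2) 2 1.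
Proof.
have h := @bandlimited_lin (fun w => cos (0 * w)) (fun w => cos (2 * w)) 2 1 1 (/ 2) (- / 2).
have e : Rabs (/ 2) * 1 + Rabs (- / 2) * 1 = 1 by rewrite Rabs_Ropp Rabs_pos_eq; lra.
rewrite e in h; apply: (bandlimited_ext _ (h _ _)).
- by move=> w; rewrite Rmult_0_l cos_0 cos_2a_sin; field.
- by apply: bandlimited_cos; rewrite Rabs_R0; lra.
- by apply: bandlimited_cos; rewrite Rabs_pos_eq; lra.
Qed.

(* [minorant w = (1 - w^2 / 100) (sin w / w)^4]. *)
Definition minorant (w : R) : R := fejer w ^ 2 - / 100 * fejer1 w ^ 2.

Lemma bandlimited_minorant : bandlimited minorant 4 5.
Proof.
have h1 : bandlimited (fun w => fejer w * fejer w) (2 + 2) (2 * 2).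
  by apply: bandlimited_mul bandlimited_fejer bandlimited_fejer; lra.
have h2 : bandlimited (fun w => fejer1 w * fejer1 w) (2 + 2) (1 * 1).
  by apply: bandlimited_mul bandlimited_fejer1 bandlimited_fejer1; lra.
rewrite (_ : 4 = 2 + 2); last by ring.
have h := @bandlimited_lin _ _ _ _ _ 1 (- / 100) h1 h2.
move=> N c u S hS.
have S0 : 0 <= S by have [] := hS 0 ltac:(rewrite Rabs_R0; lra); have := Rabs_pos (\sum_(0 <= n < N) (c n * cos (0 * u n))); lra.
rewrite (eq_bigr (fun n => c n * (1 * (fejer (u n) * fejer (u n)) + - / 100 * (fejer1 (u n) * fejer1 (u n))))); last first.
  by move=> n _; rewrite /minorant; ring.
apply: Rle_trans (h N c u S hS) _.
rewrite Rabs_R1 Rabs_Ropp Rabs_pos_eq; nra.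
Qed.

(** The unbounded factor w is absorbed into the kernels: w h(w) = fejer fejer1 - fejer1 sin^2 / 100,
    of mass at most 2 + 1/100. *)
Lemma bandlimited_minorant1 : bandlimited (fun w => w * minorant w) 4 3.
Proof.
have h1 : bandlimited (fun w => fejer w * fejer1 w) (2 + 2) (2 * 1).
  by apply: bandlimited_mul bandlimited_fejer bandlimited_fejer1; lra.
have h2 : bandlimited (fun w => fejer1 w * sin w ^ 2) (2 + 2) (1 * 1).
  by apply: bandlimited_mul bandlimited_fejer1 bandlimited_sin2; lra.
rewrite (_ : 4 = 2 + 2); last by ring.
have h := @bandlimited_lin _ _ _ _ _ 1 (- / 100) h1 h2.
move=> N c u S hS.
have S0 : 0 <= S by have [] := hS 0 ltac:(rewrite Rabs_R0; lra); have := Rabs_pos (\sum_(0 <= n < N) (c n * cos (0 * u n))); lra.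
rewrite (eq_bigr (fun n => c n * (1 * (fejer (u n) * fejer1 (u n)) + - / 100 * (fejer1 (u n) * sin (u n) ^ 2)))); last first.
  by move=> n _; rewrite /minorant -fejer1_mul -fejer_mul; ring.
apply: Rle_trans (h N c u S hS) _.
rewrite Rabs_R1 Rabs_Ropp Rabs_pos_eq; nra.
Qed.

Lemma fejer_abs_le w : Rabs (fejer w) <= 2.
Proof.
have := @abs_RInt_le_const (fun tau => 2 * (1 - tau) * cos (2 * tau * w)) 0 1 2.
rewrite -/(fejer w) Rminus_0_r Rmult_1_l; apply; first lra.
  by exists (fejer w); exact: is_RInt_fejer.
move=> tau ht; rewrite Rabs_mult (Rabs_pos_eq (2 * _)); last lra.
have : Rabs (cos (2 * tau * w)) <= 1 by apply: Rabs_le; exact: COS_bound.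
have := Rabs_pos (cos (2 * tau * w)); nra.
Qed.

Lemma sin_abs_le x : 0 <= x -> Rabs (sin x) <= x.
Proof.
move=> x0; have := @MVT_bound sin cos 0 x 1 x0 (fun u _ => is_derive_sin u)
  (fun u _ => Rabs_le _ _ (COS_bound u)); rewrite sin_0 !Rminus_0_r; lra.
Qed.

Lemma cos_ge_half x : Rabs x <= 1 -> / 2 <= cos x.
Proof.
move=> hx; have -> : cos x = cos (2 * (Rabs x / 2)).
  rewrite (_ : 2 * (Rabs x / 2) = Rabs x); last by field.
  by rewrite /Rabs; case: Rcase_abs => _ //; rewrite cos_neg.
have h0 := Rabs_pos x; have := @sin_abs_le (Rabs x / 2) ltac:(lra).
rewrite cos_2a_sin => h; have : Rabs (sin (Rabs x / 2)) ^ 2 <= (/ 2) ^ 2.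
  by apply: pow_incr; split; [exact: Rabs_pos | lra].
rewrite pow2_abs; lra.
Qed.

(** In this range the cosine in the integral is at least 1/2, and the weight 2 (1 - tau) has mass
    1. *)
Lemma fejer_ge_half w : Rabs w <= / 2 -> / 2 <= fejer w.
Proof.
move=> hw.
have d : is_RInt (fun tau => 1 - tau) 0 1 (minus (1 - 1 ^ 2 / 2) (0 - 0 ^ 2 / 2)).
  apply: (is_RInt_derive (fun tau => tau - tau ^ 2 / 2)) => tau _.
    by auto_derive => //; field.
  by apply: (@ex_derive_continuous _ R_NormedModule); auto_derive.
have := is_RInt_le _ _ _ _ _ _ Rle_0_1 d (@is_RInt_fejer w).
rewrite /minus /plus /opp /= => h; apply: Rle_trans (h _); first lra.
move=> tau ht; have : / 2 <= cos (2 * tau * w).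
  apply: cos_ge_half; rewrite Rabs_mult Rabs_pos_eq; last lra.
  by have := Rabs_pos w; nra.
nra.
Qed.

Lemma minorant_le4 w : minorant w <= 4.
Proof.
rewrite /minorant; have := pow2_ge_0 (fejer1 w).
have : fejer w ^ 2 <= 2 ^ 2 by rewrite -pow2_abs; apply: pow_incr; split; [exact: Rabs_pos | exact: fejer_abs_le].
lra.
Qed.

Lemma minorant_fact w : minorant w = (1 - w ^ 2 / 100) * fejer w ^ 2.
Proof. by rewrite /minorant -fejer_mul; field. Qed.

Lemma minorant_le0 w : 10 <= Rabs w -> minorant w <= 0.
Proof.
move=> h; rewrite minorant_fact; have := pow2_ge_0 (fejer w).
have : 10 ^ 2 <= w ^ 2 by rewrite -(pow2_abs w); apply: pow_incr; lra.
nra.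
Qed.

Lemma minorant_ge0 w : Rabs w <= 10 -> 0 <= minorant w.
Proof.
move=> h; rewrite minorant_fact; have := pow2_ge_0 (fejer w).
have : w ^ 2 <= 10 ^ 2 by rewrite -(pow2_abs w); apply: pow_incr; split => //; exact: Rabs_pos.
move=> h1 h2; apply: Rmult_le_pos => //; lra.
Qed.

Lemma minorant_ge_fifth w : Rabs w <= / 2 -> / 5 <= minorant w.
Proof.
move=> h; rewrite minorant_fact; have hF := fejer_ge_half h.
have : w ^ 2 <= (/ 2) ^ 2 by rewrite -(pow2_abs w); apply: pow_incr; split => //; exact: Rabs_pos.
have : (/ 2) ^ 2 <= fejer w ^ 2 by apply: pow_incr; lra.
nra.
Qed.

Lemma minorant_tail w : w <> 0 -> - / (100 * w ^ 2) <= minorant w.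
Proof.
move=> w0; have w2 : 0 < w ^ 2 by apply: pow2_gt_0.
have h : w ^ 2 * fejer1 w ^ 2 <= 1.
  rewrite -Rpow_mult_distr fejer1_mul.
  have [s1 s2] := SIN_bound w.
  have : sin w ^ 2 <= 1 by nra.
  have := pow2_ge_0 (sin w) => p q; nra.
have : fejer1 w ^ 2 <= / w ^ 2.
  apply: (Rmult_le_reg_l (w ^ 2)) => //; rewrite Rinv_r; lra.
rewrite /minorant Rinv_mult; have := pow2_ge_0 (fejer w); lra.
Qed.

(** Frequency w in the variable (ln n - X) / D is frequency t = w / D in ln n, up to the phase t X.
    Truncation with precision [B] gives 2 B for each of the cosine and sine sums, and the phase
    mixes the two: 4 B. *)
Lemma Dir_bandlimited_bound a s X D f M B : adm a -> 1 < s -> 0 < D -> 0 < B -> 0 <= M ->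
  bandlimited f 4 M -> (forall t, Rabs t <= 4 / D -> Cmod (Dir a s t) <= B) ->
  exists N0, forall N, (N0 <= N)%N ->
  Rabs (\sum_(0 <= n < N) (a n * nps s n * f ((ln (INR n) - X) / D))) <= M * (4 * B).
Proof.
move=> ha s1 D0 B0 M0 hf hB; have [N0 hN] := Dir_approx ha s1 B0.
exists N0 => N /hN{}hN; apply: (hf N (fun n => a n * nps s n) (fun n => (ln (INR n) - X) / D)) => w hw.
set t := w / D; have ht : Rabs t <= 4 / D.
  rewrite /t Rabs_div; last lra.
  by rewrite (Rabs_pos_eq D); [apply: Rmult_le_compat_r => //; apply/Rlt_le/Rinv_0_lt_compat | lra].
have [h1 h2] := hN t; have hb := hB t ht.
have c1 := Cmod_re (Dir a s t); have c2 := Cmod_im (Dir a s t).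
set Sc := \sum_(0 <= n < N) (a n * dcos s t n) in h1.
set Ss := \sum_(0 <= n < N) (a n * dsin s t n) in h2.
have bc : Rabs Sc <= 2 * B.
  have -> : Sc = fst (Dir a s t) - (fst (Dir a s t) - Sc) by ring.
  apply: Rle_trans (Rabs_triang _ _) _; rewrite Rabs_Ropp; lra.
have bs : Rabs Ss <= 2 * B.
  have -> : Ss = - snd (Dir a s t) - (- snd (Dir a s t) - Ss) by ring.
  apply: Rle_trans (Rabs_triang _ _) _; rewrite (Rabs_Ropp (snd (Dir a s t))).
  rewrite (Rabs_Ropp (- snd (Dir a s t) - Ss)); lra.
have cb : Rabs (cos (t * X)) <= 1 by apply: Rabs_le; exact: COS_bound.
have sb : Rabs (sin (t * X)) <= 1 by apply: Rabs_le; exact: SIN_bound.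
have key p q : Rabs p <= 1 -> Rabs q <= 1 -> Rabs (p * Sc + q * Ss) <= 4 * B.
  move=> hp hq; apply: Rle_trans (Rabs_triang _ _) _; rewrite !Rabs_mult.
  have := Rabs_pos Sc; have := Rabs_pos Ss; have := Rabs_pos p; have := Rabs_pos q; nra.
have arg n : w * ((ln (INR n) - X) / D) = t * ln (INR n) - t * X by rewrite /t; field; lra.
split.
- rewrite (eq_bigr (fun n => cos (t * X) * (a n * dcos s t n) + sin (t * X) * (a n * dsin s t n))).
    by rewrite big_split /= -!big_distrr; exact: key.
  by move=> n _; rewrite arg cos_minus /dcos /dsin; ring.
- rewrite (eq_bigr (fun n => - sin (t * X) * (a n * dcos s t n) + cos (t * X) * (a n * dsin s t n))).
    by rewrite big_split /= -!big_distrr; apply: key => //; rewrite Rabs_Ropp.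
  by move=> n _; rewrite arg sin_minus /dcos /dsin; ring.
Qed.

(* Multiplying by [X = ln n - D w_n] trades the saving [1 / X] for a logarithmic weight. *)
Lemma vonM_minorant_compare s X D B : 1 < s -> 0 < D <= 1 -> 0 < X -> 0 < B ->
  (forall t, Rabs t <= 4 / D ->
     Cmod (LA s t - zeta s t)%C <= B /\ Cmod (LB s t - zeta1 s t)%C <= B) ->
  exists N0, forall N, (N0 <= N)%N ->
  Rabs (\sum_(0 <= n < N) ((vonM n - 1) * nps s n * minorant ((ln (INR n) - X) / D))) <= 32 * B / X.
Proof.
move=> s1 [D0 D1] X0 B0 hB.
pose a n := vonM n - 1; pose b n := vonM n * ln (INR n) - ln (INR n).
have aa : adm a by apply: adm_sub; [exact: adm_vonM | exact: adm_1].
have ab : adm b by apply: adm_sub; [exact: adm_vonM_ln | exact: adm_ln].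
have [N1 h1] := @Dir_bandlimited_bound a s X D _ 3 B aa s1 D0 B0 ltac:(lra) bandlimited_minorant1
  (fun t ht => eq_ind_r (fun z => Cmod z <= B) (proj1 (hB t ht)) (Dir_sub t adm_vonM adm_1 s1)).
have [N2 h2] := @Dir_bandlimited_bound b s X D _ 5 B ab s1 D0 B0 ltac:(lra) bandlimited_minorant
  (fun t ht => eq_ind_r (fun z => Cmod z <= B) (proj2 (hB t ht)) (Dir_sub t adm_vonM_ln adm_ln s1)).
exists (maxn N1 N2) => N; rewrite geq_max => /andP[/h1{}h1 /h2{}h2].
set E := \sum_(0 <= n < N) _.
have e : X * E = \sum_(0 <= n < N) (b n * nps s n * minorant ((ln (INR n) - X) / D)) -
  D * \sum_(0 <= n < N) (a n * nps s n * ((ln (INR n) - X) / D * minorant ((ln (INR n) - X) / D))).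
  rewrite /E !big_distrr /= -sumR_sub; apply: eq_bigr => n _; rewrite /a /b; field; lra.
apply: (Rmult_le_reg_l X) => //.
rewrite (_ : X * (32 * B / X) = 32 * B); last by field; lra.
rewrite -{1}(Rabs_pos_eq X); last lra.
rewrite -Rabs_mult e; apply: Rle_trans (Rabs_triang _ _) _.
rewrite Rabs_Ropp Rabs_mult (Rabs_pos_eq D); last lra.
(* The constant 32 is 4 (5 + 3), from the two masses and D <= 1. *)
have := Rmult_le_compat_l D _ _ ltac:(lra) h1; nra.
Qed.

(** * The main term *)

(** Together with [pot_far], a discrete antiderivative: its increments from ln n to ln (n+1) stay
    below the terms of the main sum, which is then bounded below by telescoping. This part collects
    slope 1/10 on |v - X| <= D / 2. *)
Definition pot_near (X D v : R) : R :=
  Rmin (Rmax v (X - D / 2)) (X + D / 2) / 10 - (if Rle_dec (X - D / 2) v then D / 40 else 0).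
(** Essentially an antiderivative of (v - X)^(-2) off |v - X| < 10 D. The coefficients 2 and 4 pay
    for replacing integrals by sums; the truncation at 5 D on the left leaves room for the step that
    leaves the far region there. *)
Definition pot_far (X D v : R) : R := 2 / Rmax (X - v) (5 * D) - 4 / Rmax (v - X) (10 * D).

Lemma Rmax_case_le (a b : R) : (Rmax a b = a /\ b <= a) \/ (Rmax a b = b /\ a <= b).
Proof. by rewrite /Rmax; case: Rle_dec => h; [right | left]; lra. Qed.

(* The jump of the second term of [pot_near] absorbs the step across [X - D / 2]. *)
Lemma pot_near_step X D v v' i : 0 < D <= / 20 -> v <= v' <= v + i ->
  (X - 1 <= v' -> i <= D / 4) ->
  pot_near X D v' - pot_near X D v <= (if Rle_dec (Rabs (v - X)) (D / 2) then i / 10 else 0).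
Proof.
move=> [D0 D1] [v1 v2] hi; rewrite /pot_near.
case: (Rle_dec (Rabs (v - X)) (D / 2)) => h /=.
  move/Rabs_le_between: h => h; rewrite /Rmax; do ! (case: Rle_dec => ? /=); rewrite /Rmin; do ! (case: Rle_dec => ? /=); lra.
have [h1|h1] : v - X < - (D / 2) \/ D / 2 < v - X.
  by move: h; rewrite /Rabs; case: Rcase_abs => _ h; [left | right]; lra.
- case: (Rle_dec (X - 1) v') => [/hi h2|h2]; rewrite /Rmax; do ! (case: Rle_dec => ? /=); rewrite /Rmin; do ! (case: Rle_dec => ? /=); lra.
- rewrite /Rmax; do ! (case: Rle_dec => ? /=); rewrite /Rmin; do ! (case: Rle_dec => ? /=); lra.
Qed.

Lemma Rinv_le_sub a b : 0 < a -> a <= b -> / b <= / a.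
Proof. by move=> ha hab; apply: Rinv_le_contravar. Qed.

(** Left of [X] the point v' is nearer to the singularity, so i <= 2 (v' - v) suffices. Right of it
    v' is farther, and p' <= 2 p costs another factor 2. *)
Lemma pot_far_step X D v v' i : 0 < D <= / 20 -> v <= v' <= v + i -> i <= 2 * (v' - v) -> 0 < i ->
  (X - 1 <= v' -> i <= D / 4) ->
  (if Rle_dec (10 * D) (Rabs (v - X)) then i / (v - X) ^ 2 else 0) <= pot_far X D v' - pot_far X D v.
Proof.
move=> [D0 D1] [v1 v2] v3 i0 hi; rewrite /pot_far.
set m := Rmax (X - v) _; set m' := Rmax (X - v') _; set p := Rmax (v - X) _; set p' := Rmax (v' - X) _.
have mm : m' <= m by apply: Rle_max_compat_r; lra.
have pp : p <= p' by apply: Rle_max_compat_r; lra.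
have m0 : 5 * D <= m' := Rmax_r _ _; have p0 : 10 * D <= p := Rmax_r _ _.
have im : / m <= / m' by apply: Rinv_le_sub; lra.
have ip : / p' <= / p by apply: Rinv_le_sub; lra.
rewrite /Rdiv; case: Rle_dec => h; cbn [is_left]; last lra.
have [h1|h1] : 10 * D <= v - X \/ 10 * D <= X - v.
  by move: h; rewrite /Rabs; case: Rcase_abs => _ h; [right | left]; lra.
- have ep : p = v - X by rewrite /p Rmax_left.
  have ep' : p' = v' - X by rewrite /p' Rmax_left //; lra.
  have iD : i <= D / 4 by apply: hi; lra.
  suff : i * / (v - X) ^ 2 <= 4 * (/ p - / p') by lra.
  have -> : 4 * (/ p - / p') = 4 * (v' - v) * / p * / p' by rewrite ep ep'; field; lra.
  have -> : i * / (v - X) ^ 2 = i * p' * / p * / p * / p' by rewrite -ep; field; lra.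
  have -> : 4 * (v' - v) * / p * / p' = (4 * (v' - v) * p) * / p * / p * / p' by field; lra.
  have q : 0 < / p by apply: Rinv_0_lt_compat; lra.
  have q' : 0 < / p' by apply: Rinv_0_lt_compat; lra.
  do 3 (apply: Rmult_le_compat_r; first lra).
  have : p' <= 2 * p by lra.
  nra.
- have em : m = X - v by rewrite /m Rmax_left //; lra.
  have -> : (v - X) ^ 2 = m ^ 2 by rewrite em; ring.
  suff : i * / m ^ 2 <= 2 * (/ m' - / m) by lra.
  have q : 0 < / m by apply: Rinv_0_lt_compat; lra.
  have [[em' h2]|[em' h2]] := Rmax_case_le (X - v') (5 * D); rewrite -/m' in em'.
    have q' : 0 < / m' by apply: Rinv_0_lt_compat; lra.
    have -> : 2 * (/ m' - / m) = 2 * (v' - v) * m * / m * / m * / m'.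
      by rewrite em em'; field; lra.
    have -> : i * / m ^ 2 = i * m' * / m * / m * / m' by field; lra.
    do 3 (apply: Rmult_le_compat_r; first lra).
    have : i * m' <= i * m by apply: Rmult_le_compat_l; lra.
    have : i * m <= 2 * (v' - v) * m by apply: Rmult_le_compat_r; lra.
    lra.
  have iD : i <= D / 4 by apply: hi; lra.
  have qm : / m <= / (10 * D) by apply: Rinv_le_sub; lra.
  rewrite em' Rinv_mult; rewrite Rinv_mult in qm.
  have qD : 0 < / D by apply: Rinv_0_lt_compat.
  have eD : D * / D = 1 by field; lra.
  have -> : i * / m ^ 2 = i * / m * / m by field; lra.
  have : i * / m <= / 40.
    apply: (@Rle_trans _ (D / 4 * (/ 10 * / D))); last by rewrite /Rdiv; nra.
    by apply: Rmult_le_compat; lra.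
  nra.
Qed.

(** The gain near X is at least 1/10 = 1/2 times 1/5 per unit of ln n, since n^(-eta) >= 1/2 there;
    the loss comes from the tail -D^2 / (100 (v - X)^2). The hypothesis on exp (- (X - 1)) says that
    the points ln n are D/4-dense from X - 1 on. *)
Lemma minorant_sum_ge X D eta : 0 < D <= / 20 -> 1 <= X -> 0 < eta -> eta * (X + 1) <= / 2 ->
  2 * exp (- (X - 1)) <= D / 4 -> exists N0, forall N, (N0 <= N)%N ->
  D / 20 <= \sum_(0 <= n < N) (nps (1 + eta) n * minorant ((ln (INR n) - X) / D)).
Proof.
move=> [D0 D1] X1 e0 eX hX.
have iD : 0 < / D by apply: Rinv_0_lt_compat.
have DD : D * / D = 1 by field; lra.
pose pot v := pot_near X D v - D ^ 2 / 100 * pot_far X D v.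
have step n : pot (ln (INR n.+2)) - pot (ln (INR n.+1)) <=
   nps (1 + eta) n.+1 * minorant ((ln (INR n.+1) - X) / D).
  have [l1 l2] := @ln_step n.+1 isT.
  have n1 := @INR_ge1 n.+1 isT; have n0 := @INR_gt0 n.+1 isT; have eN : INR n.+2 = INR n.+1 + 1 by rewrite [LHS]S_INR.
  set i := / INR n.+1 in l2; have i0 : 0 < i by exact: Rinv_0_lt_compat.
  have i2 : i <= 2 * / INR n.+2.
    rewrite /i; apply: (Rmult_le_reg_l (INR n.+1 * INR n.+2)); first by rewrite eN; nra.
    rewrite (_ : INR n.+1 * INR n.+2 * / INR n.+1 = INR n.+2); last by field; lra.
    rewrite (_ : INR n.+1 * INR n.+2 * (2 * / INR n.+2) = 2 * INR n.+1); last by field; lra.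
    lra.
  set v := ln (INR n.+1) in l1 l2 *; set v' := ln (INR n.+2) in l1 l2 *.
  have i2p : 0 < / INR n.+2 by apply: Rinv_0_lt_compat; lra.
  have hv : v <= v' <= v + i by lra.
  have hi : X - 1 <= v' -> i <= D / 4.
    move=> h; apply: Rle_trans hX; apply: Rle_trans i2 _; apply: Rmult_le_compat_l; first lra.
    have -> : / INR n.+2 = exp (- v') by rewrite exp_Ropp exp_ln //; lra.
    by apply: exp_mono; lra.
  have s1 := @pot_near_step X D v v' i (conj D0 D1) hv hi.
  have s2 := @pot_far_step X D v v' i (conj D0 D1) hv ltac:(lra) i0 hi.
  have D2 : 0 < D ^ 2 / 100 by have := pow_lt D 2 D0; lra.
  have s3 := Rmult_le_compat_l _ _ _ (Rlt_le _ _ D2) s2.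
  rewrite nps_gt0 // -/v.
  have v0 : 0 <= v := ln_INR_ge0 _.
  have ei : exp (- (1 + eta) * v) = i * exp (- (eta * v)).
    by rewrite (_ : i = exp (- v)) -?exp_plus; [congr exp; ring | rewrite exp_Ropp exp_ln].
  have ee : exp (- (eta * v)) <= 1.
    by rewrite -exp_0; apply: exp_mono; nra.
  have ep := exp_pos (- (eta * v)).
  rewrite ei; set m := minorant _.
  have aw : Rabs ((v - X) / D) = Rabs (v - X) * / D.
    by rewrite /Rdiv Rabs_mult (Rabs_pos_eq (/ D)); lra.
  have goal : (if Rle_dec (Rabs (v - X)) (D / 2) then i / 10 else 0) -
     D ^ 2 / 100 * (if Rle_dec (10 * D) (Rabs (v - X)) then i / (v - X) ^ 2 else 0) <=
     i * exp (- (eta * v)) * m; last by rewrite /pot; lra.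
  case: Rle_dec => h1; case: Rle_dec => h2; cbn [is_left].
  - lra.
  - have mf : / 5 <= m by apply: minorant_ge_fifth; rewrite aw; nra.
    have : / 2 <= exp (- (eta * v)).
      apply: Rle_trans (exp_ge_lin _).
      have := Rle_abs (v - X); nra.
    move=> h; have : / 10 <= exp (- (eta * v)) * m by nra.
    nra.
  - have w0 : (v - X) / D <> 0.
      by move=> h; move: aw; rewrite h Rabs_R0 => h'; have := Rabs_pos (v - X); nra.
    have ml := minorant_le0 (w := (v - X) / D) ltac:(rewrite aw; nra).
    have mt := minorant_tail w0; rewrite -/m in ml mt.
    have vX : v - X <> 0 by move=> h; apply: w0; rewrite h /Rdiv Rmult_0_l.
    have e3 : D ^ 2 / 100 * (i / (v - X) ^ 2) = i * / (100 * ((v - X) / D) ^ 2).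
      by field; lra.
    rewrite e3; have : m <= exp (- (eta * v)) * m by nra.
    move=> h; have := Rmult_le_compat_l i _ _ ltac:(lra) (Rle_trans _ _ _ mt h); lra.
  - have : 0 <= m by apply: minorant_ge0; rewrite aw; nra.
    move=> h; have : 0 <= i * exp (- (eta * v)) * m by apply: Rmult_le_pos => //; nra.
    lra.
have [N0 hN0] := INR_unbounded (exp (X + 1)).
exists N0.+1 => -[|N] // hN.
rewrite sumR_recl Rmult_0_l Rplus_0_l.
apply: (@Rle_trans _ (\sum_(0 <= n < N) (pot (ln (INR n.+2)) - pot (ln (INR n.+1))))); last first.
  by apply: sumR_le => n _; exact: step.
rewrite (sumR_telescope N (fun n => pot (ln (INR n.+1)))) [INR 1]/= ln_1.
have big : X + 1 <= ln (INR N.+1).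
  rewrite -(ln_exp (X + 1)); apply: ln_le; first exact: exp_pos.
  apply: Rle_trans (Rlt_le _ _ hN0) _; apply: le_INR; lia.
set v := ln (INR N.+1) in big *; rewrite /pot /pot_near /pot_far.
rewrite (Rmax_left v); last lra.
rewrite (Rmin_right v); last lra.
rewrite (Rmax_right 0); last lra.
rewrite (Rmin_left (X - D / 2)); last lra.
rewrite (Rmax_right (X - v)); last lra.
rewrite (Rmax_left (v - X)); last lra.
rewrite (Rmax_left (X - 0)); last lra.
rewrite (Rmax_right (0 - X)); last lra.
case: Rle_dec => h1; cbn [is_left]; last lra.
case: Rle_dec => h2; cbn [is_left]; first lra.
have p1 : 0 < / (X - 0) by apply: Rinv_0_lt_compat; lra.
have p2 : 0 < / (v - X) by apply: Rinv_0_lt_compat; lra.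
have D2 : 0 < D ^ 2 by exact: pow_lt.
(* Near part: D/10 - D/40 = 3D/40. Far part: at most D/125. The difference exceeds D/20. *)
have e : D ^ 2 / 100 * (2 / (5 * D) + 4 / (10 * D)) = D * / 125 by field; lra.
have q1 : 0 <= D ^ 2 / 100 * (2 / (X - 0)) by rewrite /Rdiv; nra.
have q2 : 0 <= D ^ 2 / 100 * (4 / (v - X)) by rewrite /Rdiv; nra.
lra.
Qed.

(** * Primes in short intervals *)

Lemma prime_Z n : prime n -> Znumtheory.prime (Z.of_nat n).
Proof.
move=> pn; have n1 := prime_gt1 pn; apply/prime_alt; split; first lia.
move=> m m1 [q e]; have q0 : (0 < q)%Z by nia.
have : (Z.to_nat m %| n)%N by apply/dvdnP; exists (Z.to_nat q); nia.
by move/primeP: pn => [_ h] /h /orP[/eqP|/eqP]; lia.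
Qed.

Lemma exp_half_ge l : 0 <= l -> (l / 8) ^ 4 <= exp (l / 2).
Proof.
move=> l0; have -> : l / 2 = INR 4 * (l / 8) by rewrite /=; field.
rewrite exp_mul_INR; apply: pow_incr; have := exp_ge_lin (l / 8); lra.
Qed.

Lemma vonM_nonprime_sum_bound x : exp 1 <= x -> exists M : nat, 2 * x < INR M /\
  \sum_(0 <= n < M) (if prime n then 0 else vonM n) <= 63 * exp (ln x / 2) * ln x ^ 2.
Proof.
move=> hx; have e1 := exp_ge_lin 1; have x0 : 0 < x by lra.
have l1 : 1 <= ln x by rewrite -(ln_exp 1); apply: ln_le => //; exact: exp_pos.
set l := ln x in l1 *; set q := exp (l / 2).
have q1 : 1 <= q by have := exp_ge_lin (l / 2); rewrite /q; lra.
have qq : q * q = x by rewrite /q -exp_plus (_ : l / 2 + l / 2 = l) ?exp_ln //; field.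
have [m [m1 m2]] := nfloor_ex (2 * x) ltac:(lra).
have [rt [r1 r2]] := nfloor_ex (2 * q) ltac:(lra).
have M0 := @INR_gt0 m.+1 isT; have eM : INR m.+1 = INR m + 1 by rewrite [LHS]S_INR.
have lM : ln (INR m.+1) <= 3 * l.
  apply: (@Rle_trans _ (ln (3 * x))); first by apply: ln_le; lra.
  rewrite ln_mult; try lra; have := @ln_le_lin 3 ltac:(lra); rewrite -/l; lra.
have lM0 : 0 <= ln (INR m.+1) := ln_INR_ge0 _.
have [k [k1 k2]] := nfloor_ex (2 * ln (INR m.+1)) ltac:(lra).
exists m.+1; split; first lra.
apply: (Rle_trans _ _ _ (@vonM_nonprime_sum m.+1 rt.+1 k.+1 _ _)).
- apply/leP/INR_le; rewrite INR_muln eM (S_INR rt); nra.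
- apply/leP/INR_le; apply: Rnot_lt_le => h.
  have := ln_increasing _ _ (INR_gt0 _) h; rewrite expn_gt0 => /(_ isT).
  rewrite ln_INR_exp // S_INR [INR 2]/=; have := ln_lt_2; have := pos_INR k; rewrite (_ : 1 + 1 = 2); [nra | ring].
rewrite (S_INR rt) (S_INR k).
(* With q the square root of x: at most 3 q bases, 7 l exponents, and logarithm at most 3 l. *)
have -> : 63 * q * l ^ 2 = (3 * q) * (7 * l) * (3 * l) by ring.
have := pos_INR rt; have := pos_INR k => k0 rt0.
apply: Rmult_le_compat => //; [by apply: Rmult_le_pos; lra |].
apply: Rmult_le_compat; lra.
Qed.

(** Outside the window the terms are nonpositive; inside it h <= 4 and n^(-s) <= 1/x, so the total
    is at most (4/x) 63 x^(1/2) (ln x)^2. *)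
Lemma nonprime_part_le x s X D N : exp 1 <= x -> 1 < s ->
  (forall n, (0 < n)%N -> Rabs ((ln (INR n) - X) / D) <= 10 -> x <= INR n <= 2 * x) ->
  \sum_(0 <= n < N) ((if prime n then 0 else vonM n) * nps s n * minorant ((ln (INR n) - X) / D))
    <= 252 * ln x ^ 2 / exp (ln x / 2).
Proof.
move=> hx s1 hw; have e1 := exp_ge_lin 1; have x0 : 0 < x by lra.
have [M [hM hS]] := vonM_nonprime_sum_bound hx.
have ix : 0 < / x by exact: Rinv_0_lt_compat.
pose u n := if prime n then 0 else vonM n.
have u0 n : 0 <= u n by rewrite /u; case: ifP => _; [lra | exact: vonM_ge0].
have t n : u n * nps s n * minorant ((ln (INR n) - X) / D) <= if (n < M)%N then 4 * / x * u n else 0.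
  have P : 0 <= (if (n < M)%N then 4 * / x * u n else 0).
    by case: ifP => _; [apply: Rmult_le_pos => //; lra | lra].
  case: n P => [|n] P; first by rewrite [nps _ _]/= Rmult_0_r Rmult_0_l.
  have n0 := nps_ge0 s n.+1; have un := u0 n.+1.
  case: (Rle_lt_dec 10 (Rabs ((ln (INR n.+1) - X) / D))) => h.
    apply: Rle_trans P; have := minorant_le0 h; have := Rmult_le_pos _ _ un n0; nra.
  have [h1 h2] := hw n.+1 isT (Rlt_le _ _ h).
  have nM : (n.+1 < M)%N by apply/leP/INR_lt; lra.
  rewrite nM; have h3 : nps s n.+1 <= / x.
    apply: Rle_trans (nps_anti n.+1 (Rlt_le _ _ s1)) _.
    by have [->|//] := nps1 n.+1; apply: Rinv_le_contravar.
  have := minorant_le4 ((ln (INR n.+1) - X) / D) => h4.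
  apply: (@Rle_trans _ (u n.+1 * nps s n.+1 * 4)).
    by apply: Rmult_le_compat_l => //; exact: Rmult_le_pos.
  have := Rmult_le_compat_l _ _ _ un h3; lra.
apply: Rle_trans (sumR_le (fun n _ => t n)) _.
apply: (@Rle_trans _ (4 * / x * \sum_(0 <= n < M) u n)).
  rewrite big_distrr /=; case: (leqP N M) => NM.
    rewrite (@big_cat_nat _ _ _ N 0 M) //=.
    apply: (@Rle_trans _ (\sum_(0 <= i < N) (4 * / x * u i))).
      by apply: sumR_le => n hn; rewrite ifT; [lra | lia].
    have : 0 <= \sum_(N <= i < M) (4 * / x * u i) by apply: sumR_ge0 => n _; apply: Rmult_le_pos; [lra|].
    lra.
  rewrite (@big_cat_nat _ _ _ M 0 N) //=; last exact: ltnW.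
  rewrite (eq_big_nat (m := M) _ _ (F2 := fun=> 0)); last by move=> n hn; rewrite ifF //; lia.
  rewrite (@big1 _ _ _ _ _ _ (fun=> 0)) // Rplus_0_r.
  by apply: sumR_le => n hn; rewrite ifT; [lra | lia].
apply: Rle_trans (Rmult_le_compat_l _ _ _ _ hS) _; first lra.
set l := ln x; set q := exp (l / 2).
have q0 : 0 < q by exact: exp_pos.
have -> : x = q * q by rewrite /q -exp_plus (_ : l / 2 + l / 2 = l) ?exp_ln //; field.
by apply/Req_le; field; lra.
Qed.

(** Without a prime in the window, primes contribute at most 0, so the main term minus the error is
    at most the proper prime power part. That would give D/20 < D/50 + D/50. *)
Lemma exists_prime_of_bounds x X D eta B : exp 1 <= x -> 0 < D <= / 20 -> 1 <= X -> 0 < eta ->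
  eta * (X + 1) <= / 2 -> 2 * exp (- (X - 1)) <= D / 4 -> 0 < B ->
  (forall t, Rabs t <= 4 / D -> Cmod (LA (1 + eta) t - zeta (1 + eta) t)%C <= B /\
     Cmod (LB (1 + eta) t - zeta1 (1 + eta) t)%C <= B) ->
  (forall n, (0 < n)%N -> Rabs ((ln (INR n) - X) / D) <= 10 -> x <= INR n <= 2 * x) ->
  32 * B / X < D / 50 -> 252 * ln x ^ 2 / exp (ln x / 2) < D / 50 ->
  exists n, prime n /\ Rabs ((ln (INR n) - X) / D) <= 10.
Proof.
move=> hx hD X1 e0 eX hX B0 hB hw c1 c2; apply: NNPP => hn.
have s1 : 1 < 1 + eta by lra.
have [N1 h1] := @vonM_minorant_compare (1 + eta) X D B s1 ltac:(lra) ltac:(lra) B0 hB.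
have [N2 h2] := @minorant_sum_ge X D eta hD X1 e0 eX hX.
pose N := maxn N1 N2; have {}h1 := h1 N (leq_maxl _ _); have {}h2 := h2 N (leq_maxr _ _).
have h3 := @nonprime_part_le x (1 + eta) X D N hx s1 hw.
have : \sum_(0 <= n < N) ((vonM n - 1) * nps (1 + eta) n * minorant ((ln (INR n) - X) / D)) +
  \sum_(0 <= n < N) (nps (1 + eta) n * minorant ((ln (INR n) - X) / D)) <=
  \sum_(0 <= n < N) ((if prime n then 0 else vonM n) * nps (1 + eta) n * minorant ((ln (INR n) - X) / D)).
  rewrite -big_split /=; apply: sumR_le => n _.
  have -> : (vonM n - 1) * nps (1 + eta) n * minorant ((ln (INR n) - X) / D) +
    nps (1 + eta) n * minorant ((ln (INR n) - X) / D) =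
    vonM n * nps (1 + eta) n * minorant ((ln (INR n) - X) / D) by ring.
  case: ifP => pn; last lra.
  case: (Rle_lt_dec 10 (Rabs ((ln (INR n) - X) / D))) => h; last by case: hn; exists n; split=> //; lra.
  have := minorant_le0 h; have := Rmult_le_pos _ _ (vonM_ge0 n) (nps_ge0 (1 + eta) n); nra.
have := Rle_abs (- \sum_(0 <= n < N) ((vonM n - 1) * nps (1 + eta) n * minorant ((ln (INR n) - X) / D))).
rewrite Rabs_Ropp; lra.
Qed.

Import Znumtheory.
Open Scope R_scope.

Theorem theorem48 :
  forall eps : R, 0 < eps < 1 ->
  exists x0 : R, forall x y : R,
    x0 <= x ->
    x / Rpower (ln x) (1 - eps) <= y ->
    exists p : Z, prime p /\ x <= IZR p <= x + y.
Proof.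
move=> eps [eps0 eps1].
have [K [r [K0 [r0 hLK]]]] := @log_derivative_bounds (eps / 2) ltac:(lra).
(* 2000 comes from D / 50 = rho / 2000, 32 from [vonM_minorant_compare], and 161 from 1 + |t| <= 161
   ln x on the band. *)
pose C := 2000 * 32 * 161 * K; have C0 : 0 < C by rewrite /C; lra.
(* The first bound on ln x lets x^(1/2) beat (ln x)^3 with the constants below; the second makes (ln
   x)^(eps/2) at least e^C, hence larger than C. *)
exists (exp (Rmax (3 * 10 ^ 9) (exp (2 * C / eps)))) => x y hx hy.
have x0 : 0 < x by apply: Rlt_le_trans hx; exact: exp_pos.
have hl : Rmax (3 * 10 ^ 9) (exp (2 * C / eps)) <= ln x.
  by rewrite -(ln_exp (Rmax _ _)); apply: ln_le => //; exact: exp_pos.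
set l := ln x in hl hy.
have l1 : 3 * 10 ^ 9 <= l := Rle_trans _ _ _ (Rmax_l _ _) hl.
have l2 : exp (2 * C / eps) <= l := Rle_trans _ _ _ (Rmax_r _ _) hl.
have l0 : 0 < l by lra.
pose la := ln l; have hla : 2 * C / eps <= la by rewrite -(ln_exp (2 * C / eps)); apply: ln_le => //; exact: exp_pos.
have la0 : 0 <= la by apply: ln_ge0; lra.
have el : exp la = l by rewrite exp_ln.
pose rho := / Rpower l (1 - eps).
have erho : rho = exp (- (1 - eps) * la) by rewrite /rho /Rpower -exp_Ropp; congr exp; rewrite /la; ring.
have rho0 : 0 < rho by rewrite erho; exact: exp_pos.
have rho1 : rho <= 1.
  by rewrite erho -[X in _ <= X]exp_0; apply: exp_mono; nra.
have rhol : / l <= rho.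
  rewrite -el -exp_Ropp erho.
  by apply: exp_mono; nra.
have lrho : 1 <= l * rho by have := Rmult_le_compat_l l _ _ ltac:(lra) rhol; rewrite Rinv_r; lra.
(* The window |ln n - X| <= 10 D is then [ln x, ln x + rho / 2], and e^(rho/2) <= 1 + rho puts it
   inside [x, x + x rho]. *)
pose D := rho / 40; pose X := l + rho / 4.
have D0 : 0 < D by rewrite /D; lra.
have X0 : l <= X by rewrite /X; lra.
pose eta := Rmin r (/ (2 * (X + 1))).
have iX : 0 < / (2 * (X + 1)) by apply: Rinv_0_lt_compat; lra.
have eta0 : 0 < eta by apply: Rmin_pos; lra.
have etar : eta <= r := Rmin_l _ _.
have etaX : eta * (X + 1) <= / 2.
  have := Rmult_le_compat_r (X + 1) _ _ ltac:(lra) (Rmin_r r (/ (2 * (X + 1)))).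
  rewrite (_ : / (2 * (X + 1)) * (X + 1) = / 2); [done | field; lra].
have hexp := exp_half_ge (Rlt_le _ _ l0).
have l8 : l * (l ^ 3 / 4096) = (l / 8) ^ 4 by field.
have l3 : 0 < l ^ 3 by exact: pow_lt.
pose B := K * (161 * exp (eps / 2 * la)).
have B0 : 0 < B by rewrite /B; have := exp_pos (eps / 2 * la); nra.
have window n : Rabs ((ln (INR n) - X) / D) <= 10 -> (0 < n)%N -> x <= INR n <= x + x * rho.
  move=> h n0; have n0' := INR_gt0 n0; rewrite /Rdiv Rabs_mult (Rabs_pos_eq (/ D)) in h; last first.
    by apply/Rlt_le/Rinv_0_lt_compat.
  have {}h : Rabs (ln (INR n) - X) <= rho / 4.
    have := Rmult_le_compat_r D _ _ (Rlt_le _ _ D0) h; rewrite Rmult_assoc Rinv_l; last lra.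
    rewrite /D; lra.
  move/Rabs_le_between: h => [h1 h2]; rewrite /X in h1 h2; split.
    apply: Rnot_lt_le => /(ln_increasing _ _ n0'); rewrite -/l; lra.
  have h3 : INR n <= x * exp (rho / 2).
    apply: Rnot_lt_le => h; have := ln_increasing _ _ _ h.
    rewrite ln_mult ?ln_exp -/l //; last exact: exp_pos.
    by move=> h4; have := h4 ltac:(apply: Rmult_lt_0_compat => //; exact: exp_pos); lra.
  apply: Rle_trans h3 _; rewrite -{2}(Rmult_1_r x) -Rmult_plus_distr_l.
  apply: Rmult_le_compat_l; first lra.
  have p := exp_pos (rho / 2).
  have : exp (rho / 2) * (1 - rho / 2) <= 1.
    have := exp_ge_lin (- (rho / 2)); rewrite exp_Ropp => h.
    have := Rmult_le_compat_l _ _ _ (Rlt_le _ _ p) h; rewrite Rinv_r; lra.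
  nra.
have [| | | | | | | | | | |n [pn hn]] := @exists_prime_of_bounds x X D eta B.
- by apply: Rle_trans hx; apply: exp_mono; have := Rmax_l (3 * 10 ^ 9) (exp (2 * C / eps)); lra.
- by rewrite /D; lra.
- lra.
- exact: eta0.
- exact: etaX.
- have : exp (- (X - 1)) <= 3 * exp (- l).
    apply: (@Rle_trans _ (exp 1 * exp (- l))); last by have := exp_le_3; have := exp_pos (- l); nra.
    by rewrite -exp_plus; apply: exp_mono; lra.
  have : l * exp (- l) <= / 1000.
    have e : exp (l / 2) <= exp l by apply: exp_mono; lra.
    have : 1000 * l <= exp l.
      apply: Rle_trans e; apply: Rle_trans hexp; rewrite -l8.
      have : 10 ^ 9 <= l ^ 3 by have := pow_incr (10 ^ 3) l 3 ltac:(lra); rewrite -pow_mult.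
      nra.
    rewrite exp_Ropp => h; apply: (Rmult_le_reg_r (exp l)); first exact: exp_pos.
    rewrite Rmult_assoc Rinv_l; [lra | by have := exp_pos l; lra].
  move=> h1 h2; rewrite /D.
  have : exp (- l) <= / 1000 * rho.
    have := exp_pos (- l) => p; have := Rmult_le_compat_l rho _ _ (Rlt_le _ _ rho0) h1.
    have := Rmult_le_compat_r (exp (- l)) _ _ (Rlt_le _ _ p) lrho; lra.
  lra.
- exact: B0.
- move=> t ht.
  have [|b1 b2] := hLK (1 + eta) t; first lra.
  have : K * exp (eps / 2 * ln (Tp t)) <= B; last lra.
  apply: Rmult_le_compat_l; first lra.
  have T1 := Tp_ge1 t.
  have hT : Tp t <= 161 * l.
    rewrite /Tp; have : 4 / D <= 160 * l; last lra.
    rewrite /D; have -> : 4 / (rho / 40) = 160 * / rho by field; lra.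
    apply: Rmult_le_compat_l; first lra.
    by rewrite -(Rinv_inv l); apply: Rinv_le_contravar => //; exact: Rinv_0_lt_compat.
  have : ln (Tp t) <= ln 161 + la by rewrite -ln_mult; [apply: ln_le; lra | lra | lra].
  have l161 : 0 <= ln 161 by apply: ln_ge0; lra.
  move=> h; have e : 161 * exp (eps / 2 * la) = exp (ln 161 + eps / 2 * la) by rewrite exp_plus exp_ln; lra.
  by rewrite e; apply: exp_mono; nra.
- move=> m m0 /window /(_ m0) h; nra.
- have iX' : / X <= / l by apply: Rinv_le_contravar.
  apply: (@Rle_lt_trans _ (32 * B * / l)); first by apply: Rmult_le_compat_l; lra.
  rewrite /D /B.
  have e1 : C < exp (eps / 2 * la).
    apply: Rlt_le_trans (exp_ge_lin _).
    have : eps / 2 * (2 * C / eps) <= eps / 2 * la by apply: Rmult_le_compat_l; lra.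
    rewrite (_ : eps / 2 * (2 * C / eps) = C); [lra | field; lra].
  (* The decisive comparison: rho ln x = (ln x)^eps against an error of order (ln x)^(eps/2). *)
  have e2 : rho = exp (eps / 2 * la) * exp (eps / 2 * la) * / l.
    by rewrite erho -el -exp_Ropp -!exp_plus; congr exp; field.
  rewrite e2; have p := exp_pos (eps / 2 * la); have il : 0 < / l by exact: Rinv_0_lt_compat.
  have : C * exp (eps / 2 * la) < exp (eps / 2 * la) * exp (eps / 2 * la) by apply: Rmult_lt_compat_r.
  rewrite /C => h; have := Rmult_lt_compat_r _ _ _ il h; lra.
- rewrite -/l; have p := exp_pos (l / 2).
  apply: (Rmult_lt_reg_r (exp (l / 2) * l)); first exact: Rmult_lt_0_compat.
  rewrite (_ : 252 * l ^ 2 / exp (l / 2) * (exp (l / 2) * l) = 252 * l ^ 3); last by field; lra.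
  rewrite /D; have : exp (l / 2) <= rho / 40 / 50 * (exp (l / 2) * l) * 2000.
    have := Rmult_le_compat_l _ _ _ (Rlt_le _ _ p) lrho; lra.
  (* By [exp_half_ge], e^(l/2) >= l^4 / 4096, and 3 * 10^9 / (4096 * 2000) > 252. *)
  have : 3 * 10 ^ 9 * (l ^ 3 / 4096) <= l * (l ^ 3 / 4096) by apply: Rmult_le_compat_r; lra.
  lra.
exists (Z.of_nat n); split; first exact: prime_Z.
rewrite -INR_IZR_INZ; have [h1 h2] := window n hn (prime_gt0 pn).
split=> //; apply: Rle_trans h2 _; move: hy; rewrite -[x / _]/(x * rho); lra.
Qed.
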